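(* Let $\alpha\ge1$ be an integer, let $M\ge\sqrt\alpha\ (\ge 1)$, and let $f(z)=\prod_{k=0}^{\alpha-1}(a_k(z))^{\bar z^k}$ be a $\log$-$\alpha$-analytic function on $\mathbb{D}$ satisfying $f(0)=1$, where for each $k$, $a_k$ is $\log$-analytic on $\mathbb{D}$, $a_k(0)=a_k'(0)=1$ and $A_k(z):=\log a_k(z)=\sum_{n=0}^\infty a_{n,k}z^n$. Suppose that all non-zero coefficients $a_{n_1,k_1},a_{n_2,k_2}$ satisfy $\left|\arg\frac{a_{n_1,k_1}}{a_{n_2,k_2}}\right|\le\frac\pi2$ for all $k_1,k_2\in\{0,\ldots,\alpha-1\}$ and $n_1,n_2\in\mathbb{N}$ with $k_1\ne k_2$, $n_1\ne n_2$. If $|\log f(z)|\le M$ for all $z\in\mathbb{D}$, then $f$ is univalent in the disk $\mathbb{D}_{r_1}$ and $f(\mathbb{D}_{r_1})$ contains a schlicht disk $\mathbb{D}(w_1,\mu_1)$, where $w_1=\cosh\sigma_1$, $\mu_1=\sinh\sigma_1$, $r_1$ is the least positive root of the equation $$2-\frac{1-(\alpha+1)r^\alpha+\alpha r^{\alpha+1}}{(1-r)^2}-\frac{r\sqrt{M^2-\alpha}}{(1-r)^3}\Big[2+r^\alpha\{\alpha r-(\alpha+2)\}\Big]=0$$ and $$\sigma_1=r_1-\frac{r_1^2-r_1^{\alpha+1}}{1-r_1}-\sqrt{M^2-\alpha}\,\frac{(1-r_1^\alpha)r_1^2}{(1-r_1)^2}.$$ In particular, if $|\log f(z)|\le 1$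 for all $z\in\mathbb{D}$, then $f$ is univalent in $\mathbb{D}$ and $f(\mathbb{D})$ contains a schlicht disk $\mathbb{D}(w_1',\mu_1')$, where $w_1'=\cosh 1$ and $\mu_1'=\sinh 1$. This result is sharp.
   Context: $\mathbb{N}=\{1,2,\ldots\}$; $\mathbb{D}$ is the open unit disk in $\mathbb{C}$, $\mathbb{D}_r=\{z:|z|<r\}$ and $\mathbb{D}(w,\mu)=\{\zeta\in\mathbb{C}:|\zeta-w|<\mu\}$. A continuous function $F:\Omega\to\mathbb{C}$ on a domain $\Omega\subseteq\mathbb{C}$ is polyanalytic of order $\alpha$ if $\partial^\alpha F/\partial\bar z^\alpha=0$ on $\Omega$; equivalently $F(z)=\sum_{k=0}^{\alpha-1}\bar z^kA_k(z)$ with each $A_k$ analytic. A function $f$ is $\log$-$\alpha$-analytic if $\log f$ is polyanalytic of order $\alpha$; it is $\log$-analytic if $\alpha=1$, i.e. $\log f$ is analytic. Here $\log$ is the principal branch, with $\log1=0$, and $\log f(z)=\sum_{k=0}^{\alpha-1}\bar z^k\log a_k(z)$ for $f=\prod_k a_k^{\bar z^k}$. Univalent means injective. A schlicht disk in the range of $f$ is a disk which is the univalent image under $f$ of some region. $\arg$ denotes the principal argument in $(-\pi,\pi]$. ''Sharp'' means that the univalence radius $1$ and the radius $\sinh 1$ are best possible (cannot be replaced by larger numbers). *)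

(* Defs.v *)
From Stdlib Require Import Reals Lra.
From Coquelicot Require Import Coquelicot.
Open Scope R_scope.

Definition disk (w : C) (r : R) : C -> Prop := fun z => Cmod (z - w)%C < r.

Definition unit_disk : C -> Prop := disk (RtoC 0) 1.

Definition Cexp (z : C) : C := (exp (Re z) * cos (Im z), exp (Re z) * sin (Im z)).

(* Principal argument, in (-PI, PI]; see Arg_spec. *)
Definition Arg (z : C) : R :=
  if Rle_dec 0 (Im z) then acos (Re z / Cmod z) else - acos (Re z / Cmod z).

(* Principal logarithm of a nonzero complex number. *)
Definition Clog (z : C) : C := (ln (Cmod z), Arg z).

Lemma Arg_spec (z : C) : z <> 0%C ->
  - PI < Arg z <= PI /\ z = (Cmod z * cos (Arg z), Cmod z * sin (Arg z)).
Proof.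
intros Hz.
assert (Hm : 0 < Cmod z) by now apply Cmod_gt_0.
assert (Hq : (Cmod z)² = (Re z)² + (Im z)²)
  by (generalize (Cmod2_alt z); unfold Rsqr; simpl; lra).
set (x := Re z / Cmod z).
assert (Hx : Re z = Cmod z * x) by (unfold x; field; lra).
assert (Hx2 : (Im z)² = (Cmod z)² * (1 - x²))
  by (rewrite Hx in Hq; unfold Rsqr in *; lra).
assert (Hx1 : 0 <= 1 - x²).
{ assert (0 < (Cmod z)²) by (apply Rlt_0_sqr; lra).
  assert (0 <= (Im z)²) by apply Rle_0_sqr.
  apply Rmult_le_reg_l with ((Cmod z)²); [assumption | lra]. }
assert (Hb : -1 <= x <= 1) by (unfold Rsqr in Hx1; split; nra).
assert (Hs : Rabs (Im z) = Cmod z * sqrt (1 - x²)).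
{ rewrite <- sqrt_Rsqr_abs, Hx2, sqrt_mult_alt, sqrt_Rsqr; try lra.
  apply Rle_0_sqr. }
pose proof (acos_bound x) as Ha.
pose proof PI_RGT_0 as Hpi.
unfold Arg; fold x; destruct (Rle_dec 0 (Im z)) as [Hi | Hi].
- split; [lra |].
  rewrite cos_acos, sin_acos by assumption.
  rewrite <- Hs, <- Hx, Rabs_pos_eq by assumption.
  now destruct z.
- assert (Hi' : Im z < 0) by lra.
  rewrite cos_neg, sin_neg, cos_acos, sin_acos by assumption.
  rewrite <- Ropp_mult_distr_r, <- Hs, <- Hx, Rabs_left by assumption.
  split; [| rewrite Ropp_involutive; now destruct z].
  split; [| lra].
  destruct (Req_dec (acos x) PI) as [E | E]; [exfalso | lra].
  assert (Ex : x = -1) by (rewrite <- (cos_acos x), E, cos_PI; auto).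
  replace (1 - x²) with 0 in Hs by (rewrite Ex; unfold Rsqr; ring).
  rewrite sqrt_0, Rmult_0_r, Rabs_left in Hs by assumption; lra.
Qed.

Definition analytic_on (D : C -> Prop) (g : C -> C) : Prop :=
  forall z, D z -> @ex_derive C_AbsRing C_NormedModule g z.

(* L is log g on D: the analytic logarithm of g on D that agrees with the
   principal logarithm at 0.  When Clog (g z) is itself analytic on D, it is
   such an L; in general Im (L z) is allowed to leave (-PI, PI]. *)
Definition is_log_on (D : C -> Prop) (g L : C -> C) : Prop :=
  analytic_on D L /\ (forall z, D z -> Cexp (L z) = g z) /\ L 0%C = Clog (g 0%C).

(* u 0 * ... * u (n - 1) *)
Fixpoint Cprod (u : nat -> C) (n : nat) : C :=
  match n with
  | O => 1%C
  | S m => (Cprod u m * u m)%C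
  end.

(* log f for f = prod_k (a k)^(conj z ^ k), where A k = log (a k) *)
Definition log_f (alpha : nat) (A : nat -> C -> C) (z : C) : C :=
  sum_n (G := C_AbelianMonoid) (fun k => (Cconj z ^ k * A k z)%C) (alpha - 1).

(* f is a total function, but only its values on the unit disk are constrained.
   A k is log (a k), c n k is the coefficient of z^n in A k, and the power
   (a k z)^(conj z ^ k) means Cexp (conj z ^ k * log (a k z)). *)
Record log_analytic_class (alpha : nat) (f : C -> C) (a A : nat -> C -> C)
    (c : nat -> nat -> C) : Prop := {
  class_f0 : f 0%C = 1%C;
  class_log : forall k, (k < alpha)%nat -> is_log_on unit_disk (a k) (A k);
  class_a0 : forall k, (k < alpha)%nat -> a k 0%C = 1%C;
  class_a0' : forall k, (k < alpha)%nat ->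
    @is_derive C_AbsRing C_NormedModule (a k) (RtoC 0) (RtoC 1);
  class_series : forall k z, (k < alpha)%nat -> unit_disk z ->
    @is_pseries C_AbsRing C_NormedModule (fun n => c n k) z (A k z);
  class_f : forall z, unit_disk z ->
    f z = Cprod (fun k => Cexp (Cconj z ^ k * A k z)%C) alpha;
  class_arg : forall k1 k2 n1 n2 : nat,
    (k1 < alpha)%nat -> (k2 < alpha)%nat -> (1 <= n1)%nat -> (1 <= n2)%nat ->
    k1 <> k2 -> n1 <> n2 -> c n1 k1 <> 0%C -> c n2 k2 <> 0%C ->
    Rabs (Arg (c n1 k1 / c n2 k2)%C) <= PI / 2
}.

Definition log_bounded (alpha : nat) (A : nat -> C -> C) (M : R) : Prop :=
  forall z, unit_disk z -> Cmod (log_f alpha A z) <= M.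

(* The maps under study are defined on the unit disk only, so univalence on U
   includes U being a subset of the unit disk. *)
Definition univalent_on (f : C -> C) (U : C -> Prop) : Prop :=
  (forall z, U z -> unit_disk z) /\
  (forall z1 z2, U z1 -> U z2 -> f z1 = f z2 -> z1 = z2).

Definition C_open (U : C -> Prop) : Prop := @open C_UniformSpace U.

Definition C_connected (X : C -> Prop) : Prop :=
  forall U V : C -> Prop, C_open U -> C_open V ->
    (forall z, X z -> U z \/ V z) ->
    (exists z, X z /\ U z) -> (exists z, X z /\ V z) ->
    exists z, X z /\ U z /\ V z.

Definition region (X : C -> Prop) : Prop :=
  (exists z, X z) /\ C_open X /\ C_connected X.

(* f(U) contains the schlicht disk of center w and radius mu. *)
Definition contains_schlicht_disk (f : C -> C) (U : C -> Prop) (w : C) (mu : R)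
    : Prop :=
  0 < mu /\
  exists X : C -> Prop, region X /\ (forall z, X z -> U z) /\ univalent_on f X /\
    (forall y, disk w mu y <-> exists z, X z /\ f z = y).

Definition least_positive_root (g : R -> R) (r : R) : Prop :=
  0 < r /\ g r = 0 /\ forall s, 0 < s -> g s = 0 -> r <= s.

(* At r = 1 both quotients are 0 by convention (/ 0 = 0), so the value there is
   2 and no spurious root is created. *)
Definition radius_eq (alpha : nat) (M r : R) : R :=
  2 - (1 - (INR alpha + 1) * r ^ alpha + INR alpha * r ^ (alpha + 1)) / (1 - r) ^ 2
    - r * sqrt (M ^ 2 - INR alpha) / (1 - r) ^ 3
      * (2 + r ^ alpha * (INR alpha * r - (INR alpha + 2))).

Definition sigma1 (alpha : nat) (M r : R) : R :=
  r - (r ^ 2 - r ^ (alpha + 1)) / (1 - r)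
    - sqrt (M ^ 2 - INR alpha) * ((1 - r ^ alpha) * r ^ 2 / (1 - r) ^ 2).

(* Main.v *)
Require Import Defs.
From Stdlib Require Import Reals Lra Lia List Classical.
From Coquelicot Require Import Coquelicot.
Open Scope R_scope.

(** Write [F = log f] and [F z = z + G z].  The theorem says that [F] is a small
    perturbation of the identity, followed by [exp].

    Coefficients.  On the circle of radius [r], [F] is a double sum of terms
    [c n k * z^n * conj z^k].  Two such terms are orthogonal in mean square unless
    their frequencies [n - k] agree, and then the argument condition makes the real
    part of their inner product nonnegative.  So the mean of [|F|^2] is at least the
    sum of the squares of all the terms, which gives
    [sum |c n k|^2 <= M^2]; since [c 1 k = 1] for every [k], all the other
    coefficients satisfy [|c n k|^2 <= M^2 - alpha] ([coef_bound_sqr]).  The mean is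
    taken over roots of unity, on a truncation of the series that is uniformly close
    to [F] on the circle, so that only finite sums occur.

    Contraction.  With [N = sqrt (M^2 - alpha)], comparing the series term by term
    with geometric series shows that on [|z| <= r] the map [G] is Lipschitz with
    constant [1 - radius_eq alpha M r] and bounded by [r - sigma1 alpha M r]
    ([log_f_remainder_lipschitz], [log_f_remainder_bound], together with the closed
    forms [radius_eq_lip_sum] and [sigma1_dev_sum]).  Since [radius_eq] equals [1] at
    [0], it is positive below its least positive root [r1], so [G] is a contraction on
    each smaller disk.  Hence [F] is injective on the disk of radius [r1], and Banach's
    theorem applied to [z |-> zeta - G z] solves [F z = zeta] for every
    [|zeta| < sigma1].

    Exponential.  The same comparison gives [r1 <= 2 * sigma1], so that [|F| <= 3/2 <
    pi/2], where [exp] has a derivative of positive real part and is therefore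
    injective with Lipschitz inverse ([Cexp_expansive]).  Finally [exp] maps the disk
    of radius [s] about [0] onto a set that contains the disk of center [cosh s] and
    radius [sinh s] ([schlicht_log]).  These facts are combined in
    [schlicht_of_contraction].

    For [M = 1] the coefficient bound forces [alpha = 1] and [F z = z], so [f = exp] on
    the unit disk.  This map is also extremal: its image lies in the annulus
    [1/e < |w| < e], whose complement contains [0], and a disk inside it has diameter
    at most [e - 1/e]. *)

(** * The exponential map on small disks *)

Lemma re_minus (u v : C) : Re (u - v)%C = Re u - Re v.
Proof. destruct u, v. unfold Re. simpl. ring. Qed.

Lemma im_minus (u v : C) : Im (u - v)%C = Im u - Im v.
Proof. destruct u, v. unfold Im. simpl. ring. Qed.

Lemma Im_le_Cmod (z : C) : Rabs (Im z) <= Cmod z.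
Proof.
  eapply Rle_trans; [apply Rmax_r | apply (Rmax_Cmod z)].
Qed.

Lemma Cmod_sub_sym (u v : C) : Cmod (u - v) = Cmod (v - u).
Proof. rewrite <- Cmod_opp. f_equal. ring. Qed.

(** On the disk of radius [r < pi/2] the derivative of [exp] has real part at least
    [exp (-r) * cos r].  Integrating along the segment from [v] to [u] and projecting
    on the direction [u - v] gives the bound, as in the Noshiro-Warschawski theorem. *)
Lemma Cexp_expansive (r : R) (u v : C) :
  0 <= r < PI / 2 -> Cmod u <= r -> Cmod v <= r ->
  exp (- r) * cos r * Cmod (u - v) <= Cmod (Cexp u - Cexp v).
Proof.
  intros Hr Hu Hv.
  set (d := (u - v)%C).
  assert (Hc : 0 < cos r) by (apply cos_gt_0; lra).
  destruct (Req_dec (Cmod d) 0) as [E | Hd].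
  { rewrite E, Rmult_0_r. apply Cmod_ge_0. }
  assert (Hd' : 0 < Cmod d) by (pose proof (Cmod_ge_0 d); lra).
  (* The real part of [exp (v + t d) * conj d]. *)
  set (g := fun t : R => exp (Re v + t * Re d)
    * (cos (Im v + t * Im d) * Re d + sin (Im v + t * Im d) * Im d)).
  set (g' := fun t : R => exp (Re v + t * Re d) * cos (Im v + t * Im d)
    * (Re d ^ 2 + Im d ^ 2)).
  assert (Hg : forall t, is_derive g t (g' t)).
  { intros t. unfold g, g'. generalize (Re d) (Im d); intros p q. auto_derive; [trivial | ring]. }
  destruct (MVT_gen g 0 1 g') as [t [Ht Hmvt]].
  { intros; apply Hg. }
  { intros t _. apply continuity_pt_filterlim.
    apply (ex_derive_continuous g). exists (g' t). apply Hg. }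
  rewrite Rmin_left, Rmax_right in Ht by lra.
  assert (Hconv : forall a b, Rabs a <= r -> Rabs b <= r ->
    Rabs (b + t * (a - b)) <= r).
  { intros a b Ha Hb. apply Rabs_le.
    apply Rabs_le_between in Ha. apply Rabs_le_between in Hb.
    split; nra. }
  assert (Hx : - r <= Re v + t * Re d).
  { enough (Rabs (Re v + t * Re d) <= r) as E by (apply Rabs_le_between in E; lra).
    unfold d. rewrite re_minus.
    apply Hconv; eapply Rle_trans; try apply re_le_Cmod; assumption. }
  assert (Hy : Rabs (Im v + t * Im d) <= r).
  { unfold d. rewrite im_minus.
    apply Hconv; eapply Rle_trans; try apply Im_le_Cmod; assumption. }
  assert (Hcy : cos r <= cos (Im v + t * Im d)).
  { unfold Rabs in Hy. destruct (Rcase_abs (Im v + t * Im d)).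
    - rewrite <- (cos_neg (Im v + t * Im d)). apply cos_decr_1; lra.
    - apply cos_decr_1; lra. }
  assert (Hxe : exp (- r) <= exp (Re v + t * Re d)).
  { destruct (Req_dec (- r) (Re v + t * Re d)) as [E | E].
    - rewrite E; lra.
    - left. apply exp_increasing. lra. }
  pose proof (exp_pos (- r)) as He.
  assert (Hlow : exp (- r) * cos r * Cmod d ^ 2 <= g 1 - g 0).
  { rewrite Hmvt. unfold g'. rewrite Cmod2_alt, Rminus_0_r, Rmult_1_r.
    apply Rmult_le_compat_r.
    - pose proof (pow2_ge_0 (Re d)); pose proof (pow2_ge_0 (Im d)); lra.
    - apply Rmult_le_compat; lra. }
  assert (Hup : g 1 - g 0 <= Cmod (Cexp u - Cexp v) * Cmod d).
  { replace (g 1 - g 0) with (Re ((Cexp u - Cexp v) * Cconj d)).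
    - eapply Rle_trans; [apply Rle_abs |].
      eapply Rle_trans; [apply re_le_Cmod |].
      rewrite Cmod_mult, Cmod_conj. lra.
    - unfold g. rewrite !Rmult_1_l, !Rmult_0_l, !Rplus_0_r.
      replace (Re v + Re d) with (Re u).
      replace (Im v + Im d) with (Im u).
      + generalize d; intros e. unfold Cexp. destruct e; unfold Re, Im; simpl. ring.
      + unfold d; rewrite im_minus; ring.
      + unfold d; rewrite re_minus; ring. }
  apply Rmult_le_reg_r with (Cmod d); [assumption |].
  eapply Rle_trans; [| exact Hup]. eapply Rle_trans; [| exact Hlow].
  right; ring.
Qed.

(** * The logarithm of a disk centered at cosh s *)

Lemma sinh_nonneg (x : R) : 0 <= x -> 0 <= sinh x.
Proof.
  intros [Hx | <-].
  - left. unfold sinh. assert (exp (- x) < exp x) by (apply exp_increasing; lra). lra.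
  - rewrite sinh_0; lra.
Qed.

Lemma sinh_lt (x y : R) : x < y -> sinh x < sinh y.
Proof.
  intros H. unfold sinh.
  assert (exp x < exp y) by (apply exp_increasing; lra).
  assert (exp (- y) < exp (- x)) by (apply exp_increasing; lra). lra.
Qed.

Lemma cosh_pos (x : R) : 0 < cosh x.
Proof. unfold cosh. pose proof (exp_pos x); pose proof (exp_pos (- x)); lra. Qed.

Lemma cosh_sqr (x : R) : cosh x ^ 2 = 1 + sinh x ^ 2.
Proof.
  unfold cosh, sinh.
  assert (exp x * exp (- x) = 1) by (rewrite <- exp_plus, Rplus_opp_r; apply exp_0).
  nra.
Qed.

Lemma is_derive_cosh (x : R) : is_derive cosh x (sinh x).
Proof. apply is_derive_Reals, derivable_pt_lim_cosh. Qed.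

Lemma is_derive_sinh (x : R) : is_derive sinh x (cosh x).
Proof. apply is_derive_Reals, derivable_pt_lim_sinh. Qed.

Lemma nonneg_of_derive (g g' : R -> R) (b : R) : 0 <= b -> g 0 = 0 ->
  (forall t, is_derive g t (g' t)) -> (forall t, 0 <= t <= b -> 0 <= g' t) -> 0 <= g b.
Proof.
  intros Hb H0 Hg Hpos.
  destruct (MVT_gen g 0 b g') as [t [Ht E]].
  { intros; apply Hg. }
  { intros t _. apply continuity_pt_filterlim.
    apply (ex_derive_continuous g). exists (g' t). apply Hg. }
  rewrite Rmin_left, Rmax_right in Ht by lra.
  rewrite H0 in E. assert (0 <= g' t * (b - 0)) by (apply Rmult_le_pos; [apply Hpos | ]; lra).
  lra.
Qed.

Lemma sinh_le_mul_cosh (s : R) : 0 <= s -> sinh s <= s * cosh s.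
Proof.
  intros Hs.
  enough (0 <= s * cosh s - sinh s) by lra.
  apply (nonneg_of_derive (fun s => s * cosh s - sinh s) (fun s => s * sinh s) s); auto.
  - rewrite sinh_0; ring.
  - intros t.
    replace (t * sinh t) with (1 * cosh t + t * sinh t - cosh t) by ring.
    apply @is_derive_minus; [| apply is_derive_sinh].
    apply (is_derive_mult (fun s => s) cosh); [apply @is_derive_id | apply is_derive_cosh |].
    intros; apply Rmult_comm.
  - intros t Ht. apply Rmult_le_pos; [lra | apply sinh_nonneg; lra].
Qed.

Lemma mul_cos_le_sin (t : R) : 0 <= t <= PI -> t * cos t <= sin t.
Proof.
  intros Ht.
  enough (0 <= sin t - t * cos t) by lra.
  apply (nonneg_of_derive (fun s => sin s - s * cos s) (fun s => s * sin s) t); try lra.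
  - rewrite sin_0; ring.
  - intros s. auto_derive; [trivial | ring].
  - intros s Hs. apply Rmult_le_pos; [lra | apply sin_ge_0; lra].
Qed.

(** At [b = 0] both sides agree, and the left side decreases in [b]: with
    [s = sqrt (a^2 + b^2)] its derivative is
    [cos b * sinh s * (b / s) - sin b * cosh s], which is nonpositive because
    [sinh s <= s * cosh s] and [b * cos b <= sin b]. *)
Lemma cos_mul_cosh_le_aux (a b : R) : 0 <= b < PI / 2 ->
  cos b * cosh (sqrt (a ^ 2 + b ^ 2)) <= cosh a.
Proof.
  intros Hb.
  set (g := fun t => cos t * cosh (sqrt (a ^ 2 + t ^ 2))).
  set (g' := fun t => - sin t * cosh (sqrt (a ^ 2 + t ^ 2))
     + cos t * (sinh (sqrt (a ^ 2 + t ^ 2)) * (t / sqrt (a ^ 2 + t ^ 2)))).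
  assert (Hcont : forall t, continuity_pt g t).
  { intros t. apply continuity_pt_filterlim.
    apply (continuous_mult (fun t => cos t)).
    - apply continuous_cos.
    - apply (continuous_comp (fun t => sqrt (a ^ 2 + t ^ 2)) cosh).
      + apply (continuous_comp (fun t => a ^ 2 + t ^ 2) sqrt).
        * apply (ex_derive_continuous (fun t => a ^ 2 + t ^ 2)). auto_derive; trivial.
        * apply continuous_sqrt.
      + apply (ex_derive_continuous cosh). eexists; apply is_derive_cosh. }
  destruct (MVT_gen g 0 b g') as [t [Ht E]].
  { rewrite Rmin_left, Rmax_right by lra. intros t Ht.
    assert (Hs : 0 < a ^ 2 + t ^ 2) by (pose proof (pow2_ge_0 a); nra).
    unfold g, g'.
    apply (is_derive_mult cos (fun t => cosh (sqrt (a ^ 2 + t ^ 2)))).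
    - apply is_derive_Reals, derivable_pt_lim_cos.
    - replace (sinh (sqrt (a ^ 2 + t ^ 2)) * (t / sqrt (a ^ 2 + t ^ 2)))
        with (scal (t / sqrt (a ^ 2 + t ^ 2)) (sinh (sqrt (a ^ 2 + t ^ 2))))
        by (unfold scal; simpl; unfold mult; simpl; ring).
      apply (is_derive_comp cosh (fun t => sqrt (a ^ 2 + t ^ 2))).
      + apply is_derive_cosh.
      + auto_derive; [simpl in *; lra |]. simpl. field.
        apply Rgt_not_eq, sqrt_lt_R0. simpl in Hs; lra.
    - intros; apply Rmult_comm. }
  { intros; apply Hcont. }
  rewrite Rmin_left, Rmax_right in Ht by lra.
  assert (Hg' : g' t <= 0).
  { unfold g'. set (s := sqrt (a ^ 2 + t ^ 2)).
    assert (Hc : 0 <= cos t) by (apply cos_ge_0; lra).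
    assert (Hsn : 0 <= sin t) by (apply sin_ge_0; lra).
    pose proof (cosh_pos s) as Hch.
    destruct (sqrt_pos (a ^ 2 + t ^ 2)) as [Hs | Hs]; fold s in Hs.
    - pose proof (sinh_le_mul_cosh s (Rlt_le _ _ Hs)) as H1.
      assert (H2 : sinh s * (t / s) <= t * cosh s).
      { replace (t * cosh s) with (s * cosh s * (t / s)) by (field; lra).
        apply Rmult_le_compat_r; [| assumption].
        apply Rdiv_le_0_compat; lra. }
      assert (H3 : cos t * (sinh s * (t / s)) <= cos t * (t * cosh s))
        by (apply Rmult_le_compat_l; assumption).
      assert (H4 : t * cos t * cosh s <= sin t * cosh s).
      { apply Rmult_le_compat_r; [lra |]. apply mul_cos_le_sin; lra. }
      lra.
    - rewrite <- Hs, sinh_0, cosh_0. lra. }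
  assert (Hd : g b <= g 0) by nra.
  unfold g in Hd at 2. rewrite cos_0, Rmult_1_l in Hd.
  replace (a ^ 2 + 0 ^ 2) with (Rsqr a) in Hd by (unfold Rsqr; ring).
  rewrite sqrt_Rsqr_abs in Hd.
  eapply Rle_trans; [exact Hd |].
  right. unfold Rabs. destruct (Rcase_abs a); [| reflexivity].
  unfold cosh. rewrite Ropp_involutive. lra.
Qed.

Lemma cos_mul_cosh_le (a b : R) : - (PI / 2) < b < PI / 2 ->
  cos b * cosh (sqrt (a ^ 2 + b ^ 2)) <= cosh a.
Proof.
  intros Hb. destruct (Rle_dec 0 b).
  - apply cos_mul_cosh_le_aux; lra.
  - rewrite <- cos_neg. replace (b ^ 2) with ((- b) ^ 2) by ring.
    apply cos_mul_cosh_le_aux; lra.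
Qed.

Lemma cosh_le_cosh (x y : R) : 0 <= x <= y -> cosh x <= cosh y.
Proof.
  intros H. assert (E : 0 <= sinh x <= sinh y).
  { split; [apply sinh_nonneg; lra |].
    destruct (Req_dec x y) as [-> | N]; [lra | left; apply sinh_lt; lra]. }
  pose proof (cosh_sqr x); pose proof (cosh_sqr y).
  pose proof (cosh_pos x); pose proof (cosh_pos y). nra.
Qed.

(** Put [y = exp (a + i b)] with [|b| < pi/2].  Dividing [|y - cosh s|^2 < (sinh s)^2]
    by [2 exp a] turns it into [cosh a < cos b * cosh s], which by [cos_mul_cosh_le]
    is impossible when [s <= sqrt (a^2 + b^2)]. *)
Lemma schlicht_log (s : R) (y : C) : 0 < s -> disk (RtoC (cosh s)) (sinh s) y ->
  exists x : C, Cmod x < s /\ Cexp x = y.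
Proof.
  intros Hs Hy. unfold disk in Hy.
  destruct y as [p q].
  assert (Hsh : 0 < sinh s) by (rewrite <- sinh_0; apply sinh_lt; lra).
  assert (Hsq : (p - cosh s) ^ 2 + q ^ 2 < sinh s ^ 2).
  { pose proof (Cmod2_alt ((p, q) - RtoC (cosh s))%C) as E.
    unfold Re, Im in E; simpl in E.
    pose proof (Cmod_ge_0 ((p, q) - RtoC (cosh s))%C).
    assert (Cmod ((p, q) - RtoC (cosh s)) ^ 2 < sinh s ^ 2) by nra.
    simpl in *. nra. }
  pose proof (cosh_sqr s) as Hcs. pose proof (cosh_pos s) as Hcp.
  assert (Hp : 0 < p) by nra.
  set (m := sqrt (p ^ 2 + q ^ 2)).
  assert (Hm2 : m ^ 2 = p ^ 2 + q ^ 2) by (unfold m; rewrite pow2_sqrt; nra).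
  assert (Hm : 0 < m) by (apply sqrt_lt_R0; nra).
  set (b := atan (q / p)).
  pose proof (atan_bound (q / p)) as Hb. fold b in Hb.
  assert (Hcb : 0 < cos b) by (apply cos_gt_0; lra).
  assert (Htan : sin b = q / p * cos b).
  { rewrite <- (tan_atan (q / p)). fold b. unfold tan. field. lra. }
  assert (Hcos : p = m * cos b).
  { pose proof (sin2_cos2 b) as E. unfold Rsqr in E. rewrite Htan in E.
    assert (E2 : (m * cos b) ^ 2 = p ^ 2).
    { replace (p ^ 2) with (p ^ 2 * (q / p * cos b * (q / p * cos b) + cos b * cos b))
        by (rewrite E; ring).
      replace ((m * cos b) ^ 2) with (m ^ 2 * cos b ^ 2) by ring.
      rewrite Hm2. field. lra. }
    assert (0 < m * cos b) by nra. nra. }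
  assert (Hsin : q = m * sin b).
  { rewrite Htan. replace (m * (q / p * cos b)) with (m * cos b * (q / p)) by ring.
    rewrite <- Hcos. field. lra. }
  exists (ln m, b). split.
  - change (sqrt (ln m ^ 2 + b ^ 2) < s).
    apply Rnot_le_lt. intros Hle.
    pose proof (cos_mul_cosh_le (ln m) b ltac:(lra)) as H1.
    pose proof (cosh_le_cosh s _ (conj (Rlt_le _ _ Hs) Hle)) as H2.
    assert (H3 : cos b * cosh s <= cosh (ln m)).
    { eapply Rle_trans; [| exact H1]. apply Rmult_le_compat_l; lra. }
    assert (H4 : 2 * m * cosh (ln m) = m ^ 2 + 1).
    { unfold cosh. rewrite exp_Ropp, exp_ln by assumption. field. lra. }
    nra.
  - unfold Cexp, Re, Im; simpl. rewrite exp_ln by assumption.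
    rewrite <- Hcos, <- Hsin. reflexivity.
Qed.

(** * Quadratic approximation of the exponential *)

Lemma disk_0 (r : R) (z : C) : disk (RtoC 0) r z <-> Cmod z < r.
Proof. unfold disk. replace (z - 0)%C with z by ring. reflexivity. Qed.

Lemma Cmod_le_sum (z : C) : Cmod z <= Rabs (Re z) + Rabs (Im z).
Proof.
  pose proof (Cmod2_alt z) as E. pose proof (Cmod_ge_0 z).
  pose proof (Rabs_pos (Re z)); pose proof (Rabs_pos (Im z)).
  rewrite <- (pow2_abs (Re z)), <- (pow2_abs (Im z)) in E. nra.
Qed.

Lemma Cmod_minus_ge (u v : C) : Cmod u - Cmod v <= Cmod (u - v).
Proof.
  pose proof (Cmod_triangle (u - v) v) as H.
  replace (u - v + v)%C with u in H by ring. lra.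
Qed.

Lemma Cmod_minus_le (u v : C) : Cmod (u - v) <= Cmod u + Cmod v.
Proof.
  pose proof (Cmod_triangle u (- v)) as H. rewrite Cmod_opp in H. exact H.
Qed.

Lemma Cmod_sub_eq_0 (u v : C) : Cmod (u - v) <= 0 -> u = v.
Proof.
  intros H. assert (E : (u - v)%C = 0%C).
  { apply Cmod_eq_0. pose proof (Cmod_ge_0 (u - v)). lra. }
  replace u with (u - v + v)%C by ring. rewrite E. ring.
Qed.

Lemma Cexp_plus (u v : C) : Cexp (u + v) = (Cexp u * Cexp v)%C.
Proof.
  destruct u as [a b], v as [c d]. unfold Cexp, Re, Im; simpl.
  rewrite exp_plus, cos_plus, sin_plus. unfold Cmult; simpl.
  f_equal; ring.
Qed.

Lemma Cexp_0 : Cexp 0 = 1%C.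
Proof. unfold Cexp, Re, Im; simpl. rewrite exp_0, cos_0, sin_0, Rmult_0_r, Rmult_1_l. reflexivity. Qed.

Lemma exp_quadratic (x : R) : Rabs x <= / 2 -> 0 <= exp x - 1 - x <= 2 * x ^ 2.
Proof.
  intros Hx. apply Rabs_le_between in Hx.
  pose proof (exp_ineq1_le x) as H1. pose proof (exp_ineq1_le (- x)) as H2.
  split; [lra |].
  assert (E : exp x * exp (- x) = 1) by (rewrite <- exp_plus, Rplus_opp_r; apply exp_0).
  pose proof (exp_pos x).
  assert (H3 : exp x * (1 - x) <= 1) by nra.
  assert (H4 : 1 <= (1 - x) * (1 + x + 2 * x ^ 2)) by nra.
  nra.
Qed.

Lemma cos_quadratic (y : R) : 0 <= 1 - cos y <= y ^ 2 / 2.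
Proof.
  pose proof (COS_bound y). split; [lra |].
  replace y with (2 * (y / 2)) at 1 by field.
  rewrite cos_2a_sin.
  assert (Hs : forall t, 0 <= t -> sin t <= t).
  { intros t [Ht | <-]; [left; now apply sin_lt_x | rewrite sin_0; lra]. }
  assert (Hs' : forall t, 0 <= t -> - t <= sin t).
  { intros t Ht. destruct (Rle_dec t PI).
    - assert (0 <= sin t) by (apply sin_ge_0; lra). lra.
    - pose proof (SIN_bound t). pose proof PI2_3_2. lra. }
  assert (H2 : (sin (y / 2)) ^ 2 <= (y / 2) ^ 2).
  { destruct (Rle_dec 0 (y / 2)) as [h | h].
    - specialize (Hs _ h). specialize (Hs' _ h). nra.
    - assert (h' : 0 <= - (y / 2)) by lra.
      specialize (Hs _ h'). specialize (Hs' _ h'). rewrite sin_neg in Hs, Hs'. nra. }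
  nra.
Qed.

Lemma sin_quadratic (y : R) : Rabs y <= / 2 -> Rabs (sin y - y) <= y ^ 2.
Proof.
  assert (Hp : forall t, 0 <= t <= / 2 -> Rabs (sin t - t) <= t ^ 2).
  { intros t Ht. pose proof (mul_cos_le_sin t ltac:(pose proof PI2_3_2; lra)).
    pose proof (cos_quadratic t).
    assert (sin t <= t) by (destruct (proj1 Ht) as [h | <-];
      [left; now apply sin_lt_x | rewrite sin_0; lra]).
    apply Rabs_le. split; nra. }
  intros Hy. destruct (Rle_dec 0 y) as [h | h].
  - apply Hp. apply Rabs_le_between in Hy. lra.
  - replace (sin y - y) with (- (sin (- y) - (- y))) by (rewrite sin_neg; ring).
    rewrite Rabs_Ropp. replace (y ^ 2) with ((- y) ^ 2) by ring.
    apply Hp. apply Rabs_le_between in Hy. lra.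
Qed.

(** Serves both for the continuity of [exp] and for its derivative at [0]. *)
Lemma Cexp_quadratic (w : C) : Cmod w <= / 2 -> Cmod (Cexp w - 1 - w) <= 4 * Cmod w ^ 2.
Proof.
  intros Hw. destruct w as [x y].
  pose proof (re_le_Cmod (x, y)) as Hx. pose proof (Im_le_Cmod (x, y)) as Hy.
  pose proof (Cmod2_alt (x, y)) as E.
  unfold Re, Im in *; simpl fst in *; simpl snd in *.
  set (m := Cmod (x, y)) in *.
  assert (Hx2 : Rabs x <= / 2) by lra. assert (Hy2 : Rabs y <= / 2) by lra.
  pose proof (exp_quadratic x Hx2) as H1. pose proof (cos_quadratic y) as H2.
  pose proof (sin_quadratic y Hy2) as H3.
  apply Rabs_le_between in Hx2. apply Rabs_le_between in Hy2.
  pose proof (COS_bound y).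
  assert (Hre : Rabs (exp x * cos y - 1 - x) <= 2 * x ^ 2 + y ^ 2).
  { replace (exp x * cos y - 1 - x)
      with ((exp x - 1 - x) * cos y - (1 + x) * (1 - cos y)) by ring.
    apply Rabs_le. split; nra. }
  assert (Hexy : Rabs (y * (exp x - 1)) <= x ^ 2 + y ^ 2).
  { assert (Rabs (exp x - 1) <= 2 * Rabs x).
    { unfold Rabs at 2; destruct (Rcase_abs x); apply Rabs_le; split; nra. }
    rewrite Rabs_mult, <- (pow2_abs x), <- (pow2_abs y).
    apply Rle_trans with (Rabs y * (2 * Rabs x)).
    - apply Rmult_le_compat_l; [apply Rabs_pos | assumption].
    - pose proof (pow2_ge_0 (Rabs x - Rabs y)). lra. }
  assert (Hsy : Rabs (exp x * (sin y - y)) <= 2 * y ^ 2).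
  { assert (x ^ 2 <= / 4) by nra. pose proof (exp_pos x).
    rewrite Rabs_mult, (Rabs_pos_eq (exp x)) by lra.
    apply Rmult_le_compat; try lra. apply Rabs_pos. }
  assert (Him : Rabs (exp x * sin y - y) <= x ^ 2 + 3 * y ^ 2).
  { replace (exp x * sin y - y)
      with (exp x * (sin y - y) + y * (exp x - 1)) by ring.
    eapply Rle_trans; [apply Rabs_triang |]. lra. }
  eapply Rle_trans; [apply Cmod_le_sum |].
  rewrite E.
  replace (Re (Cexp (x, y) - 1 - (x, y))) with (exp x * cos y - 1 - x)
    by (unfold Re, Cexp; simpl; ring).
  replace (Im (Cexp (x, y) - 1 - (x, y))) with (exp x * sin y - y)
    by (unfold Im, Cexp; simpl; ring).
  nra.
Qed.

Lemma Cexp_continuous (u : C) (eps : R) : 0 < eps ->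
  exists d, 0 < d /\ forall v, Cmod (v - u) < d -> Cmod (Cexp v - Cexp u) < eps.
Proof.
  intros He. set (m := Cmod (Cexp u)). assert (Hm : 0 <= m) by apply Cmod_ge_0.
  exists (Rmin (/ 2) (eps / (3 * (m + 1)))).
  assert (H0 : 0 < eps / (3 * (m + 1))) by (apply Rdiv_lt_0_compat; lra).
  split; [apply Rmin_pos; lra |].
  intros v Hv.
  assert (Hv1 := Rlt_le_trans _ _ _ Hv (Rmin_l _ _)).
  assert (Hv2 := Rlt_le_trans _ _ _ Hv (Rmin_r _ _)).
  set (w := (v - u)%C) in *.
  assert (Hq := Cexp_quadratic w (Rlt_le _ _ Hv1)).
  assert (Hw : Cmod (Cexp w - 1) <= 3 * Cmod w).
  { replace (Cexp w - 1)%C with (Cexp w - 1 - w + w)%C by ring.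
    eapply Rle_trans; [apply Cmod_triangle |]. pose proof (Cmod_ge_0 w). nra. }
  replace (Cexp v - Cexp u)%C with (Cexp u * (Cexp w - 1))%C.
  2:{ replace v with (u + w)%C by (unfold w; ring). rewrite Cexp_plus. ring. }
  rewrite Cmod_mult. fold m.
  apply Rle_lt_trans with (m * (3 * Cmod w)); [apply Rmult_le_compat_l; lra |].
  assert (H3 : 3 * (m + 1) * Cmod w < eps).
  { replace eps with (3 * (m + 1) * (eps / (3 * (m + 1)))) by (field; lra).
    apply Rmult_lt_compat_l; lra. }
  pose proof (Cmod_ge_0 w). nra.
Qed.

(** * Topology of the complex plane *)

Lemma C_open_spec (U : C -> Prop) :
  C_open U <-> forall z, U z -> exists e, 0 < e /\ forall y, Cmod (y - z) < e -> U y.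
Proof.
  split.
  - intros H z Hz. destruct (H z Hz) as [e He].
    exists e. split; [apply cond_pos |]. intros y Hy. apply He.
    apply C_NormedModule_mixin_compat1. exact Hy.
  - intros H z Hz. destruct (H z Hz) as [e [He H']].
    assert (Hs : 0 < sqrt 2) by (apply sqrt_lt_R0; lra).
    exists (mkposreal _ (Rdiv_lt_0_compat _ _ He Hs)). intros y Hy.
    apply H'. apply C_NormedModule_mixin_compat2 in Hy. simpl in Hy.
    replace (sqrt 2 * (e / sqrt 2)) with e in Hy by (field; lra). exact Hy.
Qed.

Lemma C_filterlim_spec (u : nat -> C) (l : C) :
  filterlim u eventually (@locally C_UniformSpace l) ->
  forall e, 0 < e -> exists N, forall n, (N <= n)%nat -> Cmod (u n - l) < e.
Proof.
  intros H e He.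
  assert (Hs : 0 < sqrt 2) by (apply sqrt_lt_R0; lra).
  destruct (proj1 (filterlim_locally u l) H (mkposreal _ (Rdiv_lt_0_compat _ _ He Hs)))
    as [N HN].
  exists N. intros n Hn. specialize (HN n Hn).
  apply C_NormedModule_mixin_compat2 in HN. simpl in HN.
  replace (sqrt 2 * (e / sqrt 2)) with e in HN by (field; lra). exact HN.
Qed.

Lemma contraction_fixed_point (T : C -> C) (r q : R) : 0 <= r -> 0 <= q < 1 ->
  (forall z, Cmod z <= r -> Cmod (T z) <= r) ->
  (forall z w, Cmod z <= r -> Cmod w <= r -> Cmod (T z - T w) <= q * Cmod (z - w)) ->
  exists z, Cmod z <= r /\ T z = z.
Proof.
  intros Hr Hq HT HL.
  set (u := fun n => Nat.iter n T (RtoC 0)).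
  assert (Hu : forall n, Cmod (u n) <= r).
  { induction n; simpl; [rewrite Cmod_0; lra | apply HT, IHn]. }
  assert (Hd : forall n, Cmod (u (S n) - u n) <= q ^ n * Cmod (u 1%nat - u 0%nat)).
  { induction n; [lra |].
    change (u (S (S n))) with (T (u (S n))). change (u (S n)) with (T (u n)) at 2.
    eapply Rle_trans; [apply HL; apply Hu |].
    simpl. rewrite Rmult_assoc. apply Rmult_le_compat_l; [lra | exact IHn]. }
  assert (Hex : @ex_series C_AbsRing C_CompleteNormedModule
     (fun n => u (S n) - u n)%C).
  { apply (@ex_series_le C_AbsRing C_CompleteNormedModule _
      (fun n => q ^ n * Cmod (u 1%nat - u 0%nat))); [exact Hd |].
    apply ex_series_scal_r. apply ex_series_geom. rewrite Rabs_pos_eq; lra. }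
  destruct Hex as [l Hl].
  assert (Hsum : forall n,
    @sum_n C_AbelianMonoid (fun n => u (S n) - u n)%C n = u (S n)).
  { induction n.
    - rewrite sum_O. unfold u; simpl. ring.
    - rewrite sum_Sn, IHn. change (u (S n) + (u (S (S n)) - u (S n)) = u (S (S n)))%C. ring. }
  assert (Hlim : forall e, 0 < e -> exists n, Cmod (u n - l) < e /\ Cmod (u (S n) - l) < e).
  { intros e He. destruct (C_filterlim_spec _ _ Hl e He) as [N HN].
    exists (S N). split.
    - specialize (HN N (Nat.le_refl _)).
      change (Cmod (@sum_n C_AbelianMonoid (fun n => u (S n) - u n)%C N - l) < e) in HN.
      now rewrite Hsum in HN.
    - specialize (HN (S N) (Nat.le_succ_diag_r _)).
      change (Cmod (@sum_n C_AbelianMonoid (fun n => u (S n) - u n)%C (S N) - l) < e) in HN.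
      now rewrite Hsum in HN. }
  assert (Hlr : Cmod l <= r).
  { apply le_epsilon. intros e He. destruct (Hlim e He) as [n [Hn _]].
    rewrite Cmod_sub_sym in Hn. pose proof (Cmod_minus_ge l (u n)). specialize (Hu n). lra. }
  exists l. split; [exact Hlr |].
  apply Cmod_sub_eq_0. apply le_epsilon. intros e He.
  destruct (Hlim (e / 2) ltac:(lra)) as [n [Hn HSn]].
  replace (T l - l)%C with ((T l - T (u n)) + (u (S n) - l))%C
    by (change (u (S n)) with (T (u n)); ring).
  eapply Rle_trans; [apply Cmod_triangle |].
  assert (Cmod (T l - T (u n)) <= q * Cmod (l - u n)) by (apply HL; auto).
  rewrite (Cmod_sub_sym l) in H. pose proof (Cmod_ge_0 (u n - l)).
  assert (q * Cmod (u n - l) <= 1 * Cmod (u n - l)) by (apply Rmult_le_compat_r; lra).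
  lra.
Qed.

(** The inverse of [f] is continuous on the disk, so [X] is as connected as the disk.
    The proof moves along the preimages of a segment [p] of the disk, whose ends have
    preimages in [U] and [V], and looks at the last parameter whose preimage is in
    [U]. *)
Lemma connected_of_disk_image (f : C -> C) (X : C -> Prop) (w : C) (mu : R) :
  (forall y, disk w mu y <-> exists z, X z /\ f z = y) ->
  (forall z0, X z0 -> forall e, 0 < e -> exists d, 0 < d /\
     forall z, X z -> Cmod (f z - f z0) < d -> Cmod (z - z0) < e) ->
  C_connected X.
Proof.
  intros Hf Hinv U V HU HV Hcov [z0 [Xz0 Uz0]] [z1 [Xz1 Vz1]].
  rewrite C_open_spec in HU, HV.
  (* The segment from [f z0] to [f z1]. *)
  set (p := fun t : R => (f z0 + RtoC t * (f z1 - f z0))%C).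
  assert (Hp : forall t, 0 <= t <= 1 -> exists z, X z /\ f z = p t).
  { intros t Ht. apply Hf. unfold disk, p.
    assert (H0 : disk w mu (f z0)) by (apply Hf; eauto).
    assert (H1 : disk w mu (f z1)) by (apply Hf; eauto).
    unfold disk in H0, H1.
    replace (f z0 + RtoC t * (f z1 - f z0) - w)%C
      with (RtoC (1 - t) * (f z0 - w) + RtoC t * (f z1 - w))%C
      by (rewrite RtoC_minus; ring).
    eapply Rle_lt_trans; [apply Cmod_triangle |].
    rewrite !Cmod_mult, !Cmod_R, !Rabs_pos_eq by lra.
    pose proof (Rmax_lub_lt _ _ _ H0 H1) as Hm.
    pose proof (Rmult_le_compat_l (1 - t) _ _ ltac:(lra)
      (Rmax_l (Cmod (f z0 - w)) (Cmod (f z1 - w)))).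
    pose proof (Rmult_le_compat_l t _ _ ltac:(lra)
      (Rmax_r (Cmod (f z0 - w)) (Cmod (f z1 - w)))).
    lra. }
  assert (Hpd : forall d, 0 < d -> exists h, 0 < h /\
    forall t t', Rabs (t - t') < h -> Cmod (p t - p t') < d).
  { intros d Hd. set (m := Cmod (f z1 - f z0)).
    assert (Hm : 0 <= m) by apply Cmod_ge_0.
    exists (d / (m + 1)). split; [apply Rdiv_lt_0_compat; lra |].
    intros t t' Ht. unfold p.
    replace (f z0 + RtoC t * (f z1 - f z0) - (f z0 + RtoC t' * (f z1 - f z0)))%C
      with (RtoC (t - t') * (f z1 - f z0))%C by (rewrite RtoC_minus; ring).
    rewrite Cmod_mult, Cmod_R. fold m.
    assert (Rabs (t - t') * (m + 1) < d).
    { replace d with (d / (m + 1) * (m + 1)) by (field; lra).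
      apply Rmult_lt_compat_r; lra. }
    pose proof (Rabs_pos (t - t')). nra. }
  apply NNPP. intros Hno.
  set (E := fun t => 0 <= t <= 1 /\ exists z, X z /\ U z /\ f z = p t).
  destruct (completeness E) as [s [Hub Hlub]].
  { exists 1. intros t [Ht _]. lra. }
  { exists 0. split; [lra |]. exists z0. repeat split; auto. unfold p. ring. }
  assert (Hs0 : 0 <= s).
  { apply Hub. split; [lra |]. exists z0. repeat split; auto. unfold p. ring. }
  assert (Hs1 : s <= 1) by (apply Hlub; intros t [Ht _]; lra).
  destruct (Hp s (conj Hs0 Hs1)) as [z [Xz fz]].
  destruct (Hcov z Xz) as [Uz | Vz].
  - destruct (HU z Uz) as [e [He HeU]].
    destruct (Hinv z Xz e He) as [d [Hd Hinv']].
    destruct (Hpd d Hd) as [h [Hh Hph]].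
    destruct (Req_dec s 1) as [-> | Hs].
    + apply Hno. exists z1. repeat split; auto. apply HeU, Hinv'; auto.
      rewrite fz. unfold p. replace (f z1 - (f z0 + RtoC 1 * (f z1 - f z0)))%C with (RtoC 0) by ring.
      rewrite Cmod_0; lra.
    + set (t := Rmin 1 (s + h / 2)).
      assert (Ht : s < t <= s + h / 2).
      { unfold t. split; [apply Rmin_glb_lt; lra | apply Rmin_r]. }
      assert (Ht1 : t <= 1) by apply Rmin_l.
      destruct (Hp t ltac:(lra)) as [z' [Xz' fz']].
      assert (t <= s); [| lra]. apply Hub. split; [lra |].
      exists z'. repeat split; auto. apply HeU, Hinv'; auto.
      rewrite fz, fz'. apply Hph. rewrite Rabs_pos_eq; lra.
  - destruct (HV z Vz) as [e [He HeV]].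
    destruct (Hinv z Xz e He) as [d [Hd Hinv']].
    destruct (Hpd d Hd) as [h [Hh Hph]].
    assert (s <= s - h / 2); [| lra].
    apply Hlub. intros t Et. apply Rnot_lt_le. intros Hlt.
    pose proof (Hub t Et) as Hts.
    destruct Et as [Ht [z' [Xz' [Uz' fz']]]].
    apply Hno. exists z'. repeat split; auto. apply HeV, Hinv'; auto.
    rewrite fz, fz'. apply Hph. rewrite Rabs_left1; lra.
Qed.

(** * Exponentials of contractive perturbations of the identity *)

(** Since [|G| <= r1 - s], the map [z |-> zeta - G z] preserves the disk of radius
    [|zeta| + r1 - s < r1] when [|zeta| < s]; it is a contraction there, so that
    [z + G z = zeta] has a solution.  The condition [r1 / 2 <= s] keeps [z + G z] in the
    disk of radius [3/2], where [exp] is expansive. *)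
Lemma schlicht_of_contraction (f G : C -> C) (r1 s : R) :
  0 < r1 <= 1 -> r1 / 2 <= s ->
  (forall z, Cmod z < r1 -> f z = Cexp (z + G z)) ->
  (forall z, Cmod z < r1 -> Cmod (G z) <= r1 - s) ->
  (forall r, 0 <= r < r1 -> exists q, 0 <= q < 1 /\
     forall z w, Cmod z <= r -> Cmod w <= r -> Cmod (G z - G w) <= q * Cmod (z - w)) ->
  univalent_on f (disk (RtoC 0) r1) /\
  contains_schlicht_disk f (disk (RtoC 0) r1) (RtoC (cosh s)) (sinh s).
Proof.
  intros Hr1 Hs Hf HG HL.
  pose proof PI2_3_2 as HPI.
  assert (Hsr : s <= r1).
  { pose proof (HG 0%C ltac:(rewrite Cmod_0; lra)).
    pose proof (Cmod_ge_0 (G 0%C)). lra. }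
  set (F := fun z => (z + G z)%C).
  assert (HF : forall z, Cmod z < r1 -> Cmod (F z) <= 3 / 2).
  { intros z Hz. eapply Rle_trans; [apply Cmod_triangle |]. specialize (HG z Hz). lra. }
  set (c0 := exp (- (3 / 2)) * cos (3 / 2)).
  assert (Hc0 : 0 < c0).
  { apply Rmult_lt_0_compat; [apply exp_pos | apply cos_gt_0; lra]. }
  assert (Hexp : forall u v, Cmod u <= 3 / 2 -> Cmod v <= 3 / 2 ->
    c0 * Cmod (u - v) <= Cmod (Cexp u - Cexp v)).
  { intros; apply Cexp_expansive; auto; lra. }
  assert (HFinv : forall r, 0 <= r < r1 -> exists c, 0 < c /\ forall z w,
    Cmod z <= r -> Cmod w <= r -> c * Cmod (z - w) <= Cmod (F z - F w)).
  { intros r Hr. destruct (HL r Hr) as [q [Hq HLq]].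
    exists (1 - q). split; [lra |]. intros z w Hz Hw. specialize (HLq z w Hz Hw).
    replace (F z - F w)%C with ((z - w) - (G w - G z))%C by (unfold F; ring).
    pose proof (Cmod_minus_ge (z - w) (G w - G z)).
    rewrite (Cmod_sub_sym (G w)) in H. lra. }
  assert (Hinj : forall z1 z2, Cmod z1 < r1 -> Cmod z2 < r1 -> f z1 = f z2 -> z1 = z2).
  { intros z1 z2 H1 H2 E.
    assert (EF : Cmod (F z1 - F z2) <= 0).
    { pose proof (Hexp (F z1) (F z2) (HF _ H1) (HF _ H2)) as H.
      unfold F in H at 3 4. rewrite <- !Hf, E in H by assumption.
      replace (f z2 - f z2)%C with (RtoC 0) in H by ring. rewrite Cmod_0 in H.
      pose proof (Cmod_ge_0 (F z1 - F z2)). nra. }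
    set (r := Rmax (Cmod z1) (Cmod z2)).
    assert (Hr : 0 <= r < r1).
    { split; [eapply Rle_trans; [apply Cmod_ge_0 | apply Rmax_l] | now apply Rmax_lub_lt]. }
    destruct (HFinv r Hr) as [c [Hc H]].
    specialize (H z1 z2 (Rmax_l _ _) (Rmax_r _ _)).
    apply Cmod_sub_eq_0. pose proof (Cmod_ge_0 (z1 - z2)). nra. }
  assert (Huniv : univalent_on f (disk (RtoC 0) r1)).
  { split.
    - intros z. unfold unit_disk. rewrite !disk_0. lra.
    - intros z1 z2. rewrite !disk_0. apply Hinj. }
  split; [exact Huniv |].
  split; [rewrite <- sinh_0; apply sinh_lt; lra |].
  set (D := disk (RtoC (cosh s)) (sinh s)).
  set (X := fun z => Cmod z < r1 /\ D (f z)).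
  assert (Hsurj : forall zeta, Cmod zeta < s -> exists z, Cmod z < r1 /\ F z = zeta).
  { intros zeta Hz. set (r := Cmod zeta + (r1 - s)).
    pose proof (Cmod_ge_0 zeta).
    assert (Hr : 0 <= r < r1) by (unfold r; lra).
    destruct (HL r Hr) as [q [Hq HLq]].
    destruct (contraction_fixed_point (fun z => (zeta - G z)%C) r q) as [z [Hzr E]].
    - lra.
    - lra.
    - intros z Hzr. eapply Rle_trans; [apply Cmod_minus_le |].
      pose proof (HG z ltac:(lra)). unfold r; lra.
    - intros z w Hzr Hwr.
      replace (zeta - G z - (zeta - G w))%C with (G w - G z)%C by ring.
      rewrite Cmod_sub_sym. now apply HLq.
    - exists z. split; [lra |]. unfold F. rewrite <- E at 1. ring. }
  assert (Himg : forall y, D y <-> exists z, X z /\ f z = y).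
  { intros y. split.
    - intros Hy. destruct (schlicht_log s y ltac:(lra) Hy) as [zeta [Hz <-]].
      destruct (Hsurj zeta Hz) as [z [Hzr E]].
      exists z. assert (Ef : f z = Cexp zeta) by (rewrite Hf by assumption; fold (F z); now rewrite E).
      repeat split; auto. now rewrite Ef.
    - intros [z [[_ Hz] <-]]. exact Hz. }
  assert (HFs : forall z, X z -> Cmod (F z) < s).
  { intros z [Hz Dz]. destruct (schlicht_log s (f z) ltac:(lra) Dz) as [zeta [Hzeta E]].
    replace (F z) with zeta; [exact Hzeta |].
    apply Cmod_sub_eq_0.
    pose proof (Hexp zeta (F z) ltac:(lra) (HF z Hz)) as H.
    unfold F in H at 2. rewrite <- Hf, E in H by assumption.
    replace (f z - f z)%C with (RtoC 0) in H by ring. rewrite Cmod_0 in H.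
    pose proof (Cmod_ge_0 (zeta - F z)). nra. }
  assert (Hcinv : forall z0, X z0 -> forall e, 0 < e -> exists d, 0 < d /\
     forall z, X z -> Cmod (f z - f z0) < d -> Cmod (z - z0) < e).
  { intros z0 Xz0 e He. pose proof (HFs z0 Xz0) as Hz0.
    (* Points whose image under [F] has modulus at most [t] stay in a disk of radius
       [r < r1], on which [F] is bi-Lipschitz. *)
    set (t := (Cmod (F z0) + s) / 2).
    set (r := t + (r1 - s)).
    assert (Hr : 0 <= r < r1).
    { unfold r, t. pose proof (Cmod_ge_0 (F z0)). lra. }
    destruct (HFinv r Hr) as [c [Hc Hcr]].
    assert (Hd1 : 0 < c0 * (t - Cmod (F z0))) by (apply Rmult_lt_0_compat; unfold t; lra).
    assert (Hd2 : 0 < c0 * (c * e)) by (apply Rmult_lt_0_compat; [exact Hc0 | now apply Rmult_lt_0_compat]).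
    exists (Rmin (c0 * (t - Cmod (F z0))) (c0 * (c * e))).
    split; [now apply Rmin_pos |].
    intros z Xz Hlt.
    assert (Hl1 := Rlt_le_trans _ _ _ Hlt (Rmin_l _ _)).
    assert (Hl2 := Rlt_le_trans _ _ _ Hlt (Rmin_r _ _)).
    pose proof (Hexp (F z) (F z0) (HF z (proj1 Xz)) (HF z0 (proj1 Xz0))) as H.
    unfold F in H at 3 4. rewrite <- !Hf in H by (apply Xz || apply Xz0).
    assert (HF1 : Cmod (F z - F z0) < t - Cmod (F z0)) by (apply Rmult_lt_reg_l with c0; lra).
    assert (HF2 : Cmod (F z - F z0) < c * e) by (apply Rmult_lt_reg_l with c0; lra).
    assert (Hle : forall x, Cmod x < r1 -> Cmod (F x) <= t -> Cmod x <= r).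
    { intros x Hx Hxt. replace x with (F x - G x)%C by (unfold F; ring).
      eapply Rle_trans; [apply Cmod_minus_le |]. specialize (HG x Hx). unfold r; lra. }
    specialize (Hcr z z0).
    apply Rmult_lt_reg_l with c; [lra |].
    eapply Rle_lt_trans; [apply Hcr |]; try exact HF2.
    - apply Hle; [apply Xz |]. pose proof (Cmod_minus_ge (F z) (F z0)). lra.
    - apply Hle; [apply Xz0 |]. unfold t; lra. }
  exists X. repeat split.
  - destruct (proj1 (Himg (RtoC (cosh s)))) as [z [Xz _]].
    + unfold D, disk. replace (RtoC (cosh s) - RtoC (cosh s))%C with (RtoC 0) by ring.
      rewrite Cmod_0, <- sinh_0. apply sinh_lt; lra.
    + now exists z.
  - apply C_open_spec. intros z [Hz Dz].
    set (r := (Cmod z + r1) / 2).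
    assert (Hr : 0 <= r < r1) by (pose proof (Cmod_ge_0 z); unfold r; lra).
    destruct (HL r Hr) as [q [Hq HLq]].
    assert (Hgap : 0 < sinh s - Cmod (f z - RtoC (cosh s))) by (unfold D, disk in Dz; lra).
    destruct (Cexp_continuous (F z) _ Hgap) as [d [Hd Hcont]].
    exists (Rmin (r - Cmod z) (d / 2)).
    split; [apply Rmin_pos; unfold r; lra |].
    intros y Hy.
    assert (Hy1 := Rlt_le_trans _ _ _ Hy (Rmin_l _ _)).
    assert (Hy2 := Rlt_le_trans _ _ _ Hy (Rmin_r _ _)).
    pose proof (Cmod_minus_ge y z) as Hyz.
    assert (Hyr : Cmod y <= r) by lra.
    split; [lra |].
    unfold D, disk.
    replace (f y - RtoC (cosh s))%C with ((f y - f z) + (f z - RtoC (cosh s)))%C by ring.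
    eapply Rle_lt_trans; [apply Cmod_triangle |].
    enough (Cmod (f y - f z) < sinh s - Cmod (f z - RtoC (cosh s))) by lra.
    rewrite (Hf y), (Hf z) at 1 by lra. apply Hcont.
    replace (y + G y - F z)%C with ((y - z) + (G y - G z))%C by (unfold F; ring).
    eapply Rle_lt_trans; [apply Cmod_triangle |].
    specialize (HLq y z Hyr ltac:(unfold r; lra)).
    pose proof (Cmod_ge_0 (y - z)). nra.
  - now apply (connected_of_disk_image f X (RtoC (cosh s)) (sinh s)).
  - intros z [Hz _]. now apply disk_0.
  - intros z [Hz _]. apply disk_0. lra.
  - intros z1 z2 [H1 _] [H2 _]. now apply Hinj.
  - apply Himg.
  - apply Himg.
Qed.

(** * Finite sums over lists *)

Definition rsum {I : Type} (l : list I) (x : I -> R) : R :=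
  fold_right (fun i s => x i + s) 0 l.

Definition csum {I : Type} (l : list I) (u : I -> C) : C :=
  fold_right (fun i s => (u i + s)%C) (RtoC 0) l.

Lemma rsum_ext {I} (l : list I) (x y : I -> R) :
  (forall i, In i l -> x i = y i) -> rsum l x = rsum l y.
Proof.
  induction l as [| i l IH]; simpl; intros H; [reflexivity |].
  rewrite IH, H; auto.
Qed.

Lemma csum_ext {I} (l : list I) (u v : I -> C) :
  (forall i, In i l -> u i = v i) -> csum l u = csum l v.
Proof.
  induction l as [| i l IH]; simpl; intros H; [reflexivity |].
  rewrite IH, H; auto.
Qed.

Lemma rsum_plus {I} (l : list I) (x y : I -> R) :
  rsum l (fun i => x i + y i) = rsum l x + rsum l y.
Proof. induction l as [| i l IH]; simpl; [ring | rewrite IH; ring]. Qed.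

Lemma csum_minus {I} (l : list I) (u v : I -> C) :
  csum l (fun i => u i - v i)%C = (csum l u - csum l v)%C.
Proof. induction l as [| i l IH]; simpl; [ring | rewrite IH; ring]. Qed.

Lemma rsum_scal {I} (l : list I) (a : R) (x : I -> R) :
  rsum l (fun i => a * x i) = a * rsum l x.
Proof. induction l as [| i l IH]; simpl; [ring | rewrite IH; ring]. Qed.

Lemma csum_scal {I} (l : list I) (a : C) (u : I -> C) :
  csum l (fun i => a * u i)%C = (a * csum l u)%C.
Proof. induction l as [| i l IH]; simpl; [ring | rewrite IH; ring]. Qed.

Lemma rsum_le {I} (l : list I) (x y : I -> R) :
  (forall i, In i l -> x i <= y i) -> rsum l x <= rsum l y.
Proof.
  induction l as [| i l IH]; simpl; intros H; [lra |].
  apply Rplus_le_compat; auto.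
Qed.

Lemma rsum_const {I} (l : list I) (a : R) : rsum l (fun _ => a) = INR (length l) * a.
Proof.
  induction l as [| i l IH]; [simpl; ring |].
  simpl length. rewrite S_INR. simpl. rewrite IH. ring.
Qed.

Lemma rsum_nonneg {I} (l : list I) (x : I -> R) :
  (forall i, In i l -> 0 <= x i) -> 0 <= rsum l x.
Proof.
  intros H. pose proof (rsum_le l (fun _ => 0) x H) as H'.
  rewrite rsum_const in H'. lra.
Qed.

Lemma rsum_app {I} (l1 l2 : list I) (x : I -> R) :
  rsum (l1 ++ l2) x = rsum l1 x + rsum l2 x.
Proof. induction l1 as [| i l IH]; simpl; [ring | rewrite IH; ring]. Qed.

Lemma csum_app {I} (l1 l2 : list I) (u : I -> C) :
  csum (l1 ++ l2) u = (csum l1 u + csum l2 u)%C.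
Proof. induction l1 as [| i l IH]; simpl; [ring | rewrite IH; ring]. Qed.

Lemma rsum_map {I J} (g : I -> J) (l : list I) (x : J -> R) :
  rsum (map g l) x = rsum l (fun i => x (g i)).
Proof. induction l as [| i l IH]; simpl; [reflexivity | now rewrite IH]. Qed.

Lemma csum_map {I J} (g : I -> J) (l : list I) (u : J -> C) :
  csum (map g l) u = csum l (fun i => u (g i)).
Proof. induction l as [| i l IH]; simpl; [reflexivity | now rewrite IH]. Qed.

Lemma rsum_switch {I J} (l : list I) (l' : list J) (x : I -> J -> R) :
  rsum l (fun i => rsum l' (x i)) = rsum l' (fun j => rsum l (fun i => x i j)).
Proof.
  induction l as [| i l IH]; simpl.
  - rewrite rsum_const. ring.
  - now rewrite rsum_plus, IH.
Qed.

Lemma csum_list_prod {I J} (l : list I) (l' : list J) (u : I * J -> C) :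
  csum (list_prod l l') u = csum l (fun i => csum l' (fun j => u (i, j))).
Proof.
  induction l as [| i l IH]; simpl; [reflexivity |].
  now rewrite csum_app, csum_map, IH.
Qed.

Lemma Cmod_csum_le {I} (l : list I) (u : I -> C) :
  Cmod (csum l u) <= rsum l (fun i => Cmod (u i)).
Proof.
  induction l as [| i l IH]; simpl; [rewrite Cmod_0; lra |].
  eapply Rle_trans; [apply Cmod_triangle |]. lra.
Qed.

Lemma rsum_incl {I} (l l' : list I) (x : I -> R) :
  NoDup l' -> incl l' l -> (forall i, 0 <= x i) -> rsum l' x <= rsum l x.
Proof.
  intros Hnd. revert l. induction Hnd as [| i l' Hi Hnd IH]; intros l Hincl Hx.
  - apply rsum_nonneg; auto.
  - destruct (in_split i l (Hincl i (in_eq _ _))) as [l1 [l2 ->]].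
    assert (H : rsum l' x <= rsum (l1 ++ l2) x).
    { apply IH; [| exact Hx]. intros j Hj.
      assert (Hji : j <> i) by (intros ->; contradiction).
      specialize (Hincl j (in_cons _ _ _ Hj)).
      apply in_app_iff. apply in_app_iff in Hincl. simpl in Hincl.
      destruct Hincl as [? | [? | ?]]; auto. congruence. }
    rewrite rsum_app in *. simpl. lra.
Qed.

Lemma sum_n_csum (u : nat -> C) (n : nat) :
  @sum_n C_AbelianMonoid u n = csum (seq 0 (S n)) u.
Proof.
  induction n as [| n IH].
  - rewrite sum_O. simpl. ring.
  - rewrite sum_Sn, IH, (seq_S (S n)), csum_app. simpl.
    change (@plus C_AbelianMonoid) with Cplus. ring.
Qed.

(** * Mean squares of sums with nonnegative inner products *)

Lemma Cmod_sqr_plus (u v : C) :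
  Cmod (u + v) ^ 2 = Cmod u ^ 2 + Cmod v ^ 2 + 2 * Re (u * Cconj v)%C.
Proof.
  rewrite !Cmod2_alt. destruct u, v; unfold Re, Im; simpl; ring.
Qed.

Lemma Re_mult_conj_csum {I} (l : list I) (t : C) (u : I -> C) :
  Re (t * Cconj (csum l u))%C = rsum l (fun i => Re (t * Cconj (u i))%C).
Proof.
  induction l as [| i l IH].
  - unfold Re; simpl; ring.
  - change (csum (i :: l) u) with (u i + csum l u)%C.
    change (rsum (i :: l) ?x) with (x i + rsum l x).
    rewrite Cplus_conj, Cmult_plus_distr_l, re_plus, IH. reflexivity.
Qed.

(** Bessel's inequality with orthogonality weakened: dropping nonnegative inner
    products from the expansion of the square of the sum only makes it smaller. *)
Lemma superorthogonal_sum {I J} (l : list I) (s : list J) (t : I -> J -> C) :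
  NoDup l ->
  (forall p q, In p l -> In q l -> p <> q ->
     0 <= rsum s (fun j => Re (t p j * Cconj (t q j))%C)) ->
  rsum l (fun p => rsum s (fun j => Cmod (t p j) ^ 2))
    <= rsum s (fun j => Cmod (csum l (fun p => t p j)) ^ 2).
Proof.
  intros Hnd. induction Hnd as [| p l Hp Hnd IH]; intros H.
  - apply rsum_nonneg. intros; apply pow2_ge_0.
  - change (rsum (p :: l) ?x) with (x p + rsum l x). cbv beta.
    rewrite (rsum_ext s (fun j => Cmod (csum (p :: l) (fun p => t p j)) ^ 2) (fun j => Cmod (t p j) ^ 2 +
      Cmod (csum l (fun q => t q j)) ^ 2
      + 2 * rsum l (fun q => Re (t p j * Cconj (t q j))%C))).
    2:{ intros j _. change (csum (p :: l) ?u) with (u p + csum l u)%C.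
        rewrite Cmod_sqr_plus, Re_mult_conj_csum. reflexivity. }
    rewrite 2!rsum_plus, rsum_scal.
    assert (0 <= rsum l (fun q => rsum s (fun j => Re (t p j * Cconj (t q j))%C))).
    { apply rsum_nonneg. intros q Hq. apply H; simpl; auto. intros ->; contradiction. }
    rewrite rsum_switch in H0.
    assert (rsum l (fun p => rsum s (fun j => Cmod (t p j) ^ 2))
      <= rsum s (fun j => Cmod (csum l (fun p => t p j)) ^ 2)).
    { apply IH. intros; apply H; simpl; auto. }
    lra.
Qed.

(** * Orthogonality over roots of unity *)

(** Each term times [2 sin h] is a difference of two sines, so the sum telescopes. *)
Lemma sum_cos_seq (h : R) (n : nat) :
  2 * sin h * rsum (seq 0 n) (fun j => cos (INR j * (2 * h)))
    = sin (INR n * (2 * h) - h) + sin h.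
Proof.
  induction n as [| n IH].
  - simpl. rewrite Rmult_0_l, Rminus_0_l, sin_neg. ring.
  - rewrite seq_S, rsum_app, Rmult_plus_distr_l, IH, S_INR. simpl.
    replace ((INR n + 1) * (2 * h) - h) with (INR n * (2 * h) + h) by ring.
    rewrite sin_plus, sin_minus. ring.
Qed.

Lemma sum_sin_seq (h : R) (n : nat) :
  2 * sin h * rsum (seq 0 n) (fun j => sin (INR j * (2 * h)))
    = cos h - cos (INR n * (2 * h) - h).
Proof.
  induction n as [| n IH].
  - simpl. rewrite Rmult_0_l, Rminus_0_l, cos_neg. ring.
  - rewrite seq_S, rsum_app, Rmult_plus_distr_l, IH, S_INR. simpl.
    replace ((INR n + 1) * (2 * h) - h) with (INR n * (2 * h) + h) by ring.
    rewrite cos_plus, cos_minus. ring.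
Qed.

Lemma sum_trig_zero (h : R) (n : nat) : sin h <> 0 -> sin (INR n * h) = 0 ->
  rsum (seq 0 n) (fun j => cos (INR j * (2 * h))) = 0 /\
  rsum (seq 0 n) (fun j => sin (INR j * (2 * h))) = 0.
Proof.
  intros Hh Hn.
  assert (Hs : sin (INR n * (2 * h)) = 0).
  { replace (INR n * (2 * h)) with (2 * (INR n * h)) by ring.
    rewrite sin_2a, Hn. ring. }
  assert (Hc : cos (INR n * (2 * h)) = 1).
  { replace (INR n * (2 * h)) with (2 * (INR n * h)) by ring.
    rewrite cos_2a_sin, Hn. ring. }
  pose proof (sum_cos_seq h n) as H1. pose proof (sum_sin_seq h n) as H2.
  rewrite sin_minus, Hs, Hc in H1. rewrite cos_minus, Hs, Hc in H2.
  split; apply Rmult_eq_reg_l with (2 * sin h); lra.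
Qed.

Definition cis (x : R) : C := (cos x, sin x).

Lemma cis_plus (x y : R) : cis (x + y) = (cis x * cis y)%C.
Proof.
  unfold cis, Cmult; simpl. rewrite cos_plus, sin_plus. f_equal; ring.
Qed.

Lemma cis_conj (x : R) : Cconj (cis x) = cis (- x).
Proof. unfold cis, Cconj; simpl. now rewrite cos_neg, sin_neg. Qed.

Lemma cis_pow (x : R) (n : nat) : (cis x ^ n)%C = cis (INR n * x).
Proof.
  induction n as [| n IH].
  - simpl. rewrite Rmult_0_l. unfold cis. now rewrite cos_0, sin_0.
  - rewrite Cpow_S, IH, <- cis_plus, S_INR. f_equal. ring.
Qed.

Lemma Cmod_cis (x : R) : Cmod (cis x) = 1.
Proof.
  unfold Cmod, cis; simpl fst; simpl snd.
  replace (cos x ^ 2 + sin x ^ 2) with 1; [apply sqrt_1 |].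
  pose proof (sin2_cos2 x) as E. unfold Rsqr in E. lra.
Qed.

Lemma sin_INR_PI (a b : nat) : sin ((INR a - INR b) * PI) = 0.
Proof.
  apply sin_eq_0_1. exists (Z.of_nat a - Z.of_nat b)%Z.
  now rewrite minus_IZR, <- !INR_IZR_INZ.
Qed.

(** The sample points are the [n]-th roots of unity; the frequency [a - b] is nonzero
    and smaller than [n] in absolute value, so no aliasing occurs. *)
Lemma rsum_cis_zero (n a b : nat) (w : C) : (a <> b)%nat -> (a < n)%nat -> (b < n)%nat ->
  rsum (seq 0 n) (fun j => Re (w * cis ((INR a - INR b) * (INR j * (2 * (PI / INR n)))))%C) = 0.
Proof.
  intros Hab Ha Hb.
  assert (Hn : 0 < INR n) by (apply lt_0_INR; lia).
  pose proof PI_RGT_0 as HPI.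
  set (h := (INR a - INR b) * (PI / INR n)).
  assert (Hsh : sin h <> 0).
  { assert (Hpos : forall a b : nat, (b < a)%nat -> (a < n)%nat ->
      0 < sin ((INR a - INR b) * (PI / INR n))).
    { intros p q Hpq Hpn. apply lt_INR in Hpq. apply lt_INR in Hpn.
      pose proof (pos_INR q).
      assert (0 < PI / INR n) by (apply Rdiv_lt_0_compat; lra).
      apply sin_gt_0; [apply Rmult_lt_0_compat; lra |].
      replace PI with (INR n * (PI / INR n)) at 2 by (field; lra).
      apply Rmult_lt_compat_r; lra. }
    destruct (Nat.lt_gt_cases a b) as [Hc _]. destruct (Hc Hab) as [Hlt | Hlt].
    - specialize (Hpos b a Hlt Hb).
      replace h with (- ((INR b - INR a) * (PI / INR n))) by (unfold h; ring).
      rewrite sin_neg. lra.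
    - specialize (Hpos a b Hlt Ha). unfold h. lra. }
  destruct (sum_trig_zero h n Hsh) as [H1 H2].
  { unfold h. replace (INR n * ((INR a - INR b) * (PI / INR n)))
      with ((INR a - INR b) * PI) by (field; lra). apply sin_INR_PI. }
  rewrite (rsum_ext _ _ (fun j => Re w * cos (INR j * (2 * h)) + (- Im w) * sin (INR j * (2 * h)))).
  - rewrite rsum_plus, !rsum_scal, H1, H2. ring.
  - intros j _. rewrite re_mult.
    replace ((INR a - INR b) * (INR j * (2 * (PI / INR n)))) with (INR j * (2 * h))
      by (unfold h; ring).
    unfold cis, Re, Im; simpl. ring.
Qed.

(** * Tails of power series *)

Lemma pow_n_Cpow (z : C) (n : nat) : @pow_n C_Ring z n = (z ^ n)%C.
Proof.
  induction n as [| n IH]; [reflexivity |].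
  simpl. rewrite IH. reflexivity.
Qed.

Lemma pseries_partial_sums (c : nat -> C) (z l : C) :
  @is_pseries C_AbsRing C_NormedModule c z l ->
  forall e, 0 < e -> exists N, forall n, (N <= n)%nat ->
    Cmod (csum (seq 0 (S n)) (fun i => c i * z ^ i)%C - l) < e.
Proof.
  intros H e He. destruct (C_filterlim_spec _ _ H e He) as [N HN].
  exists N. intros n Hn. specialize (HN n Hn).
  rewrite (csum_ext _ _ (fun i => z ^ i * c i)%C) by (intros; ring).
  rewrite <- sum_n_csum.
  rewrite (sum_n_ext _ (fun k => @scal C_AbsRing C_NormedModule
    (@pow_n C_AbsRing z k) (c k))); [exact HN |].
  intros k. rewrite <- pow_n_Cpow. reflexivity.
Qed.

Lemma bounded_of_eventually (x : nat -> R) (B : R) (N : nat) :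
  (forall n, (N <= n)%nat -> x n <= B) -> exists B', forall n, x n <= B'.
Proof.
  revert B. induction N as [| N IH]; intros B H.
  - exists B. intros n; apply H; lia.
  - apply (IH (Rmax B (x N))). intros n Hn.
    destruct (Nat.eq_dec n N) as [-> | Hne]; [apply Rmax_r |].
    eapply Rle_trans; [apply H; lia | apply Rmax_l].
Qed.

Lemma pseries_coef_bounded (c : nat -> C) (rho : R) (l : C) : 0 <= rho ->
  @is_pseries C_AbsRing C_NormedModule c (RtoC rho) l ->
  exists B, forall n, Cmod (c n) * rho ^ n <= B.
Proof.
  intros Hr H. destruct (pseries_partial_sums c _ l H 1 Rlt_0_1) as [N HN].
  apply (bounded_of_eventually _ 2 (S N)). intros n Hn.
  destruct n as [| n]; [lia |].
  pose proof (HN n ltac:(lia)) as H1. pose proof (HN (S n) ltac:(lia)) as H2.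
  rewrite (seq_S (S n)), csum_app in H2. cbn [csum fold_right] in H2.
  set (S := csum (seq 0 (S n)) _) in *. simpl Nat.add in H2.
  replace (Cmod (c (Datatypes.S n)) * rho ^ Datatypes.S n)
    with (Cmod (c (Datatypes.S n) * RtoC rho ^ Datatypes.S n)).
  2:{ rewrite Cmod_mult, Cmod_pow, Cmod_R, Rabs_pos_eq by lra. reflexivity. }
  replace (c (Datatypes.S n) * RtoC rho ^ Datatypes.S n)%C
    with ((S + (c (Datatypes.S n) * RtoC rho ^ Datatypes.S n + RtoC 0) - l) - (S - l))%C
    by ring.
  eapply Rle_trans; [apply Cmod_minus_le |]. lra.
Qed.

(** Comparison with the geometric series of ratio [t]. *)
Lemma pseries_tail (c : nat -> C) (z l : C) (rho B t : R) (K : nat) :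
  0 < rho -> 0 <= t < 1 -> Cmod z <= t * rho ->
  (forall n, (K < n)%nat -> Cmod (c n) * rho ^ n <= B) ->
  @is_pseries C_AbsRing C_NormedModule c z l ->
  Cmod (l - csum (seq 0 (S K)) (fun i => c i * z ^ i)%C) <= B * (t ^ S K / (1 - t)).
Proof.
  intros Hrho Ht Hz HB Hl.
  assert (HB0 : 0 <= B).
  { eapply Rle_trans; [| apply (HB (S K)); lia].
    apply Rmult_le_pos; [apply Cmod_ge_0 | apply pow_le; lra]. }
  set (P := fun n => csum (seq 0 (S n)) (fun i => c i * z ^ i)%C).
  assert (Hp : forall p, Cmod (P (K + p)%nat - P K) <= B * ((t ^ S K - t ^ S (K + p)) / (1 - t))).
  { induction p as [| p IH].
    - rewrite Nat.add_0_r. replace (P K - P K)%C with (RtoC 0) by ring.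
      rewrite Cmod_0. right. field. lra.
    - rewrite Nat.add_succ_r. unfold P at 1. rewrite seq_S, csum_app.
      fold (P (K + p)%nat). cbn [csum fold_right Nat.add].
      set (n := S (K + p)).
      replace (P (K + p)%nat + (c n * z ^ n + RtoC 0) - P K)%C
        with ((P (K + p)%nat - P K) + c n * z ^ n)%C by ring.
      eapply Rle_trans; [apply Cmod_triangle |].
      assert (Hn : Cmod (c n * z ^ n) <= B * t ^ n).
      { rewrite Cmod_mult, Cmod_pow.
        apply Rle_trans with (Cmod (c n) * (t * rho) ^ n).
        - apply Rmult_le_compat_l; [apply Cmod_ge_0 |].
          apply pow_incr. split; [apply Cmod_ge_0 | exact Hz].
        - rewrite Rpow_mult_distr.
          replace (Cmod (c n) * (t ^ n * rho ^ n)) with (Cmod (c n) * rho ^ n * t ^ n) by ring.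
          apply Rmult_le_compat_r; [apply pow_le; lra | apply HB; unfold n; lia]. }
      replace (B * ((t ^ S K - t ^ S n) / (1 - t)))
        with (B * ((t ^ S K - t ^ n) / (1 - t)) + B * t ^ n) by (simpl; field; lra).
      unfold n in *. lra. }
  apply le_epsilon. intros e He.
  destruct (pseries_partial_sums c z l Hl e He) as [N HN].
  specialize (HN (K + N)%nat ltac:(lia)). fold (P (K + N)%nat) in HN. fold (P K).
  replace (l - P K)%C with ((l - P (K + N)%nat) + (P (K + N)%nat - P K))%C by ring.
  eapply Rle_trans; [apply Cmod_triangle |].
  rewrite Cmod_sub_sym in HN. specialize (Hp N).
  assert (B * ((t ^ S K - t ^ S (K + N)) / (1 - t)) <= B * (t ^ S K / (1 - t))).
  { apply Rmult_le_compat_l; [exact HB0 |].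
    apply Rmult_le_compat_r; [left; apply Rinv_0_lt_compat; lra |].
    pose proof (pow_le t (S (K + N)) (proj1 Ht)). lra. }
  lra.
Qed.

(** * The coefficients of order zero and one *)

Lemma Clog_1 : Clog 1 = RtoC 0.
Proof.
  unfold Clog, Arg. rewrite Cmod_1. simpl.
  destruct (Rle_dec 0 0); [| lra].
  replace (1 / 1) with 1 by field. rewrite ln_1, acos_1. reflexivity.
Qed.

Lemma is_derive_at_0 (g : C -> C) (l : C) :
  @is_derive C_AbsRing C_NormedModule g (RtoC 0) l ->
  forall e, 0 < e -> exists d, 0 < d /\ forall z, Cmod z < d ->
    Cmod (g z - g (RtoC 0) - z * l) <= e * Cmod z.
Proof.
  intros [_ H] e He.
  destruct (H (RtoC 0) (fun P HP => HP) (mkposreal e He)) as [d Hd].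
  exists d. split; [apply cond_pos |]. intros z Hz.
  assert (E0 : Cmod (z - RtoC 0) = Cmod z) by (f_equal; ring).
  assert (Hb : @ball (AbsRing_UniformSpace C_AbsRing) (RtoC 0) d z).
  { change (Cmod (z - RtoC 0) < d). rewrite E0. exact Hz. }
  specialize (Hd z Hb).
  change (Cmod (g z - g (RtoC 0) - (z - RtoC 0) * l) <= e * Cmod (z - RtoC 0)) in Hd.
  rewrite E0 in Hd. replace (z - RtoC 0)%C with z in Hd by ring. exact Hd.
Qed.

Lemma coef_0 (alpha : nat) (f : C -> C) (a A : nat -> C -> C) (c : nat -> nat -> C) (k : nat) :
  log_analytic_class alpha f a A c -> (k < alpha)%nat -> c 0%nat k = RtoC 0.
Proof.
  intros Hc Hk. destruct (class_log _ _ _ _ _ Hc k Hk) as [_ [_ HA0]].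
  rewrite (class_a0 _ _ _ _ _ Hc k Hk), Clog_1 in HA0.
  assert (H0 : unit_disk 0%C) by (apply disk_0; rewrite Cmod_0; lra).
  assert (Hh : unit_disk (RtoC (/ 2))) by (apply disk_0; rewrite Cmod_R, Rabs_pos_eq; lra).
  destruct (pseries_coef_bounded _ (/ 2) _ ltac:(lra) (class_series _ _ _ _ _ Hc k _ Hk Hh))
    as [B HB].
  pose proof (pseries_tail _ _ _ (/ 2) B 0 0 ltac:(lra) ltac:(lra)
    ltac:(rewrite Cmod_0; lra) (fun n _ => HB n) (class_series _ _ _ _ _ Hc k _ Hk H0)) as H.
  rewrite HA0 in H. simpl in H.
  apply Cmod_sub_eq_0. rewrite Cmod_sub_sym.
  replace (RtoC 0 - (c 0%nat k * 1 + 0))%C with (RtoC 0 - c 0%nat k)%C in H by ring.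
  lra.
Qed.

(** [a k = exp (A k)] has derivative [c 1 k] at [0], because [A k z = c 1 k * z + O(z^2)]
    and [exp w = 1 + w + O(w^2)]. *)
Lemma coef_1 (alpha : nat) (f : C -> C) (a A : nat -> C -> C) (c : nat -> nat -> C) (k : nat) :
  log_analytic_class alpha f a A c -> (k < alpha)%nat -> c 1%nat k = RtoC 1.
Proof.
  intros Hc Hk. pose proof (coef_0 _ _ _ _ _ _ Hc Hk) as Hc0.
  destruct (class_log _ _ _ _ _ Hc k Hk) as [_ [HE _]].
  assert (Hh : unit_disk (RtoC (/ 2))) by (apply disk_0; rewrite Cmod_R, Rabs_pos_eq; lra).
  destruct (pseries_coef_bounded _ (/ 2) _ ltac:(lra) (class_series _ _ _ _ _ Hc k _ Hk Hh))
    as [B HB].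
  assert (HB0 : 0 <= B).
  { eapply Rle_trans; [| apply (HB 0%nat)].
    apply Rmult_le_pos; [apply Cmod_ge_0 | simpl; lra]. }
  set (c1 := c 1%nat k). set (L := Cmod c1 + 8 * B).
  assert (HL : 0 <= L) by (pose proof (Cmod_ge_0 c1); unfold L; lra).
  assert (HA : forall z, Cmod z <= / 4 -> Cmod (A k z - c1 * z) <= 8 * B * Cmod z ^ 2).
  { intros z Hz. pose proof (Cmod_ge_0 z).
    assert (Hz1 : unit_disk z) by (apply disk_0; lra).
    pose proof (pseries_tail _ z _ (/ 2) B (2 * Cmod z) 1 ltac:(lra) ltac:(lra)
      ltac:(lra) (fun n _ => HB n) (class_series _ _ _ _ _ Hc k _ Hk Hz1)) as H1.
    simpl in H1. rewrite Hc0 in H1. fold c1 in H1.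
    replace (A k z - (0 * 1 + (c1 * (z * 1) + 0)))%C with (A k z - c1 * z)%C in H1 by ring.
    eapply Rle_trans; [exact H1 |].
    replace (8 * B * Cmod z ^ 2) with (B * (8 * Cmod z ^ 2)) by ring.
    apply Rmult_le_compat_l; [exact HB0 |].
    apply Rmult_le_reg_r with (1 - 2 * Cmod z); [lra |].
    unfold Rdiv. rewrite Rmult_assoc, Rinv_l by lra. nra. }
  apply Cmod_sub_eq_0. apply le_epsilon. intros e He. rewrite Rplus_0_l.
  destruct (is_derive_at_0 _ _ (class_a0' _ _ _ _ _ Hc k Hk) (e / 2) ltac:(lra))
    as [d [Hd Hda]].
  set (D := 8 * B + 4 * L ^ 2 + 1).
  assert (HD : 0 < D) by (unfold D; pose proof (pow2_ge_0 L); lra).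
  (* A real point close to [0]: within the range of the derivative estimate, with
     [|A k x| <= 1/2], and such that the quadratic error is at most [e / 2 * x]. *)
  set (x := Rmin (Rmin (d / 2) (/ 4)) (Rmin (e / 2 / D) (/ (2 * (L + 1))))).
  assert (Hx : 0 < x).
  { unfold x. repeat apply Rmin_pos; try lra.
    - apply Rdiv_lt_0_compat; lra.
    - apply Rinv_0_lt_compat; lra. }
  assert (Hx1 : x <= d / 2) by (unfold x; eapply Rle_trans; apply Rmin_l).
  assert (Hx2 : x <= / 4) by (unfold x; eapply Rle_trans; [apply Rmin_l | apply Rmin_r]).
  assert (Hx3 : x <= e / 2 / D) by (unfold x; eapply Rle_trans; [apply Rmin_r | apply Rmin_l]).
  assert (Hx4 : x <= / (2 * (L + 1))) by (unfold x; eapply Rle_trans; apply Rmin_r).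
  assert (Hmx : Cmod (RtoC x) = x) by (rewrite Cmod_R, Rabs_pos_eq; lra).
  specialize (HA (RtoC x) ltac:(lra)). specialize (Hda (RtoC x) ltac:(lra)).
  assert (Ux : unit_disk (RtoC x)) by (apply disk_0; lra).
  rewrite Hmx in HA, Hda.
  set (w := A k (RtoC x)) in *.
  assert (Hw : Cmod w <= L * x).
  { replace w with ((w - c1 * x) + c1 * x)%C by ring.
    eapply Rle_trans; [apply Cmod_triangle |]. rewrite Cmod_mult, Hmx. unfold L.
    assert (8 * B * x ^ 2 <= 8 * B * x) by (apply Rmult_le_compat_l; nra). lra. }
  assert (HLx : L * x <= / 2).
  { assert ((L + 1) * x <= (L + 1) * / (2 * (L + 1))) by (apply Rmult_le_compat_l; lra).
    replace ((L + 1) * / (2 * (L + 1))) with (/ 2) in H by (field; lra). lra. }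
  pose proof (Cexp_quadratic w ltac:(lra)) as Hq.
  unfold w in Hq at 1. rewrite (HE _ Ux) in Hq.
  rewrite (class_a0 _ _ _ _ _ Hc k Hk) in Hda.
  assert (Hfin : Cmod (c1 - RtoC 1) * x <= e * x).
  { rewrite <- Hmx at 1. rewrite <- Cmod_mult.
    replace ((c1 - RtoC 1) * x)%C
      with ((a k x - 1 - x * 1) - ((a k x - 1 - w) + (w - c1 * x)))%C by ring.
    eapply Rle_trans; [apply Cmod_minus_le |].
    assert (Cmod ((a k x - 1 - w) + (w - c1 * x)) <= (4 * L ^ 2 + 8 * B) * x ^ 2).
    { eapply Rle_trans; [apply Cmod_triangle |].
      assert (Cmod w ^ 2 <= (L * x) ^ 2) by (apply pow_incr; split; [apply Cmod_ge_0 | exact Hw]).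
      nra. }
    assert (D * x <= e / 2).
    { replace (e / 2) with (D * (e / 2 / D)) by (field; lra).
      apply Rmult_le_compat_l; lra. }
    unfold D in *. nra. }
  apply Rmult_le_reg_r with x; assumption.
Qed.

(** * The coefficient bound *)

(** The argument condition enters the coefficient bound only in this form. *)
Lemma Re_mult_conj_nonneg (u v : C) :
  (u <> 0%C -> v <> 0%C -> Rabs (Arg (u / v)%C) <= PI / 2) -> 0 <= Re (u * Cconj v)%C.
Proof.
  intros H.
  destruct (Ceq_dec u 0) as [-> | Hu].
  { rewrite re_mult. unfold Re, Im; simpl. lra. }
  destruct (Ceq_dec v 0) as [-> | Hv].
  { rewrite re_mult. unfold Re, Im; simpl. lra. }
  specialize (H Hu Hv). apply Rabs_le_between in H.
  assert (Hne : (u / v)%C <> 0%C).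
  { intros E. apply Hu. replace u with (u / v * v)%C by (field; exact Hv). rewrite E. ring. }
  destruct (Arg_spec _ Hne) as [_ E].
  assert (Hre : 0 <= Re (u / v)%C).
  { rewrite E. unfold Re; simpl. apply Rmult_le_pos; [apply Cmod_ge_0 |].
    apply cos_ge_0; lra. }
  replace (u * Cconj v)%C with (u / v * (v * Cconj v))%C by (field; exact Hv).
  rewrite <- Cmod2_conj, re_scal_r.
  apply Rmult_le_pos; [exact Hre | apply pow2_ge_0].
Qed.

Lemma eventually_all_lt (P : nat -> nat -> Prop) (a : nat) :
  (forall k, (k < a)%nat -> exists K0, forall K, (K0 <= K)%nat -> P k K) ->
  exists K0, forall K, (K0 <= K)%nat -> forall k, (k < a)%nat -> P k K.
Proof.
  induction a as [| a IH]; intros H.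
  - exists 0%nat. intros; lia.
  - destruct IH as [K1 H1]; [intros; apply H; lia |].
    destruct (H a ltac:(lia)) as [K2 H2].
    exists (Nat.max K1 K2). intros K HK k Hk.
    destruct (Nat.eq_dec k a) as [-> | Hne]; [apply H2 | apply H1]; lia.
Qed.

Lemma log_f_csum (alpha : nat) (A : nat -> C -> C) (z : C) : (1 <= alpha)%nat ->
  log_f alpha A z = csum (seq 0 alpha) (fun k => Cconj z ^ k * A k z)%C.
Proof.
  intros Ha. unfold log_f. rewrite sum_n_csum.
  now replace (S (alpha - 1)) with alpha by lia.
Qed.

(** The index [p] is the pair of the exponents of [conj z] and of [z], in this order. *)
Definition log_term (c : nat -> nat -> C) (p : nat * nat) (z : C) : C :=
  (Cconj z ^ fst p * (c (snd p) (fst p) * z ^ snd p))%C.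

Definition log_trunc (alpha K : nat) (c : nat -> nat -> C) (z : C) : C :=
  csum (list_prod (seq 0 alpha) (seq 1 K)) (fun p => log_term c p z).

(** The approximation is uniform on the disk of radius [r].  This matters because the
    number of sample points used for the mean square grows with [K]. *)
Lemma log_trunc_approx (alpha : nat) (f : C -> C) (a A : nat -> C -> C)
    (c : nat -> nat -> C) (r e : R) :
  (1 <= alpha)%nat -> log_analytic_class alpha f a A c -> 0 <= r < 1 -> 0 < e ->
  exists K0, forall K, (K0 <= K)%nat -> forall z, Cmod z <= r ->
    Cmod (log_f alpha A z - log_trunc alpha K c z) <= e.
Proof.
  intros Ha Hc Hr He.
  assert (HINR : 0 < INR alpha) by (apply lt_0_INR; lia).
  assert (He' : 0 < e / INR alpha) by (apply Rdiv_lt_0_compat; lra).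
  destruct (eventually_all_lt (fun k K => forall z, Cmod z <= r ->
    Cmod (A k z - csum (seq 0 (S K)) (fun i => c i k * z ^ i)%C) <= e / INR alpha) alpha)
    as [K0 HK0].
  { intros k Hk. set (rho := (1 + r) / 2).
    assert (Hrho : r < rho < 1) by (unfold rho; lra).
    assert (Urho : unit_disk (RtoC rho)) by (apply disk_0; rewrite Cmod_R, Rabs_pos_eq; lra).
    destruct (pseries_coef_bounded _ rho _ ltac:(lra) (class_series _ _ _ _ _ Hc k _ Hk Urho))
      as [B HB].
    assert (HB0 : 0 <= B).
    { eapply Rle_trans; [| apply (HB 0%nat)].
      apply Rmult_le_pos; [apply Cmod_ge_0 | simpl; lra]. }
    set (t := r / rho).
    assert (Ht : 0 <= t < 1).
    { unfold t. split; [apply Rdiv_le_0_compat; lra |].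
      apply Rmult_lt_reg_r with rho; [lra |].
      unfold Rdiv. rewrite Rmult_assoc, Rinv_l; lra. }
    assert (Hy : 0 < e / INR alpha * (1 - t) / (B + 1)).
    { apply Rdiv_lt_0_compat; [apply Rmult_lt_0_compat |]; lra. }
    destruct (pow_lt_1_zero t ltac:(rewrite Rabs_pos_eq; lra) _ Hy) as [N HN].
    exists N. intros K HK z Hz.
    eapply Rle_trans.
    - apply (pseries_tail _ z _ rho B t K); try lra.
      + unfold t. replace (r / rho * rho) with r by (field; lra). exact Hz.
      + intros n _. apply HB.
      + apply (class_series _ _ _ _ _ Hc k z Hk). apply disk_0. lra.
    - specialize (HN (S K) ltac:(lia)).
      assert (Hp : 0 <= t ^ S K) by (apply pow_le; lra).
      rewrite Rabs_pos_eq in HN by exact Hp.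
      apply Rle_trans with ((B + 1) * (t ^ S K / (1 - t))).
      + apply Rmult_le_compat_r; [apply Rdiv_le_0_compat |]; lra.
      + replace (e / INR alpha)
          with ((B + 1) * (e / INR alpha * (1 - t) / (B + 1) / (1 - t))) by (field; lra).
        apply Rmult_le_compat_l; [lra |]. apply Rmult_le_compat_r; [| lra].
        left; apply Rinv_0_lt_compat; lra. }
  exists K0. intros K HK z Hz.
  rewrite log_f_csum by assumption. unfold log_trunc. rewrite csum_list_prod.
  rewrite <- csum_minus.
  eapply Rle_trans; [apply Cmod_csum_le |].
  apply Rle_trans with (rsum (seq 0 alpha) (fun _ => e / INR alpha)).
  - apply rsum_le. intros k Hk. apply in_seq in Hk.
    unfold log_term; simpl fst; simpl snd. rewrite csum_scal.
    replace (csum (seq 1 K) (fun i => c i k * z ^ i)%C)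
      with (csum (seq 0 (S K)) (fun i => c i k * z ^ i)%C).
    2:{ simpl. rewrite (coef_0 _ _ _ _ _ k Hc) by lia. ring. }
    specialize (HK0 K HK k ltac:(lia) z Hz).
    set (T := csum _ _) in *.
    replace (Cconj z ^ k * A k z - Cconj z ^ k * T)%C
      with (Cconj z ^ k * (A k z - T))%C by ring.
    rewrite Cmod_mult, Cmod_pow, Cmod_conj.
    rewrite <- (Rmult_1_l (e / INR alpha)).
    apply Rmult_le_compat; try apply Cmod_ge_0; try exact HK0.
    + apply pow_le, Cmod_ge_0.
    + rewrite <- (pow1 k). apply pow_incr. split; [apply Cmod_ge_0 | lra].
  - rewrite rsum_const, length_seq. right. field. lra.
Qed.

(** The product has frequency [(n - k) - (n' - k')], written here as a difference of two
    naturals. *)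
Lemma Re_log_term_mult_conj (c : nat -> nat -> C) (r x : R) (k n k' n' : nat) :
  Re (log_term c (k, n) (RtoC r * cis x) * Cconj (log_term c (k', n') (RtoC r * cis x)))%C
  = r ^ (n + k + n' + k')
    * Re (c n k * Cconj (c n' k') * cis ((INR (n + k') - INR (k + n')) * x))%C.
Proof.
  unfold log_term; simpl fst; simpl snd.
  rewrite <- re_scal_l. f_equal.
  rewrite !Cmult_conj, !Cpow_conj, !Cmult_conj, !Cconj_conj, !Cpow_mult_l.
  replace (Cconj (RtoC r)) with (RtoC r) by (unfold Cconj, RtoC; simpl; f_equal; ring).
  rewrite cis_conj, !cis_pow, RtoC_pow, !Cpow_add_r.
  replace ((INR (n + k') - INR (k + n')) * x)
    with (INR k * - x + INR n * x + INR k' * x + INR n' * - x) by (rewrite !plus_INR; ring).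
  rewrite !cis_plus. ring.
Qed.

Lemma NoDup_list_prod {I J} (l : list I) (l' : list J) :
  NoDup l -> NoDup l' -> NoDup (list_prod l l').
Proof.
  intros Hl Hl'. induction Hl as [| i l Hi Hl IH]; simpl; [constructor |].
  apply NoDup_app; [| exact IH |].
  - apply (NoDup_map_inv snd). rewrite map_map. simpl. now rewrite map_id.
  - intros [i' j] Hin Hin'. apply in_map_iff in Hin. destruct Hin as [j' [E _]].
    injection E as <- <-. apply in_prod_iff in Hin'. now apply Hi.
Qed.

(** With [S (K + alpha)] sample points all frequencies that occur are resolved.  Two
    different terms of the same frequency differ in both exponents, which is when the
    argument condition applies. *)
Lemma bessel_log_trunc (alpha : nat) (f : C -> C) (a A : nat -> C -> C)
    (c : nat -> nat -> C) (K : nat) (r : R) :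
  log_analytic_class alpha f a A c -> 0 <= r ->
  INR (S (K + alpha)) * rsum (list_prod (seq 0 alpha) (seq 1 K))
      (fun p => (Cmod (c (snd p) (fst p)) * r ^ (snd p + fst p)) ^ 2)
  <= rsum (seq 0 (S (K + alpha))) (fun j => Cmod (log_trunc alpha K c
       (RtoC r * cis (INR j * (2 * (PI / INR (S (K + alpha)))))))%C ^ 2).
Proof.
  intros Hc Hr. set (N := S (K + alpha)).
  set (z := fun j => (RtoC r * cis (INR j * (2 * (PI / INR N))))%C).
  rewrite <- rsum_scal.
  eapply Rle_trans; [| apply (superorthogonal_sum _ (seq 0 N) (fun p j => log_term c p (z j)))].
  - right. apply rsum_ext. intros [k n] _.
    rewrite (rsum_ext _ _ (fun _ => (Cmod (c n k) * r ^ (n + k)) ^ 2)).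
    + rewrite rsum_const, length_seq. reflexivity.
    + intros j _. f_equal. unfold log_term, z; simpl fst; simpl snd.
      rewrite !Cmod_mult, !Cmod_pow, Cmod_conj, Cmod_mult, Cmod_cis, Cmod_R, Rabs_pos_eq by lra.
      rewrite Rmult_1_r, pow_add. ring.
  - apply NoDup_list_prod; apply seq_NoDup.
  - intros [k n] [k' n'] Hp Hq Hpq.
    apply in_prod_iff in Hp, Hq. rewrite !in_seq in Hp, Hq.
    unfold z. rewrite (rsum_ext _ _ _ (fun j _ => Re_log_term_mult_conj c r _ k n k' n')).
    rewrite rsum_scal. apply Rmult_le_pos; [apply pow_le, Hr |].
    destruct (Nat.eq_dec (n + k') (k + n')) as [E | Hne].
    + apply rsum_nonneg. intros j _. rewrite E.
      unfold Rminus. rewrite Rplus_opp_r, Rmult_0_l.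
      replace (cis 0) with (RtoC 1) by (unfold cis; rewrite cos_0, sin_0; reflexivity).
      rewrite Cmult_1_r. apply Re_mult_conj_nonneg. intros Hu Hv.
      apply (class_arg _ _ _ _ _ Hc); auto; try lia.
      * intros ->. apply Hpq. f_equal. lia.
      * intros ->. apply Hpq. f_equal. lia.
    + right. symmetry. apply rsum_cis_zero; unfold N; lia.
Qed.

Lemma one_minus_pow_le (d : R) (m : nat) : 0 <= d <= 1 -> 1 - INR m * d <= (1 - d) ^ m.
Proof.
  intros Hd. induction m as [| m IH]; [simpl; lra |].
  rewrite S_INR. simpl.
  assert (0 <= (1 - d) ^ m <= 1).
  { split; [apply pow_le; lra |]. rewrite <- (pow1 m) at 2. apply pow_incr; lra. }
  nra.
Qed.

(** Keep from [bessel_log_trunc] only the [alpha] terms with coefficient [c 1 j = 1]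
    and the one with coefficient [c n k], then let [K] go to infinity and [r] to [1]. *)
Lemma coef_bound_sqr (alpha : nat) (f : C -> C) (a A : nat -> C -> C)
    (c : nat -> nat -> C) (M : R) (n k : nat) :
  log_analytic_class alpha f a A c -> log_bounded alpha A M ->
  (2 <= n)%nat -> (k < alpha)%nat -> INR alpha + Cmod (c n k) ^ 2 <= M ^ 2.
Proof.
  intros Hc HM Hn Hk.
  assert (HM0 : 0 <= M).
  { eapply Rle_trans; [apply Cmod_ge_0 | apply (HM 0%C)].
    apply disk_0. rewrite Cmod_0. lra. }
  (* [m] bounds twice the degree of every term that is kept. *)
  set (Q := INR alpha + Cmod (c n k) ^ 2). set (m := (2 * (n + alpha))%nat).
  assert (HQ0 : 0 <= Q).
  { unfold Q. pose proof (pos_INR alpha). pose proof (pow2_ge_0 (Cmod (c n k))). lra. }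
  assert (H1 : forall r e, 0 <= r < 1 -> 0 < e -> r ^ m * Q <= (M + e) ^ 2).
  { intros r e Hr He.
    destruct (log_trunc_approx alpha f a A c r e ltac:(lia) Hc Hr He) as [K0 HK0].
    set (K := (K0 + n)%nat). specialize (HK0 K ltac:(unfold K; lia)).
    pose proof (bessel_log_trunc alpha f a A c K r Hc (proj1 Hr)) as HB.
    set (N := S (K + alpha)) in *.
    assert (HN : 0 < INR N) by (apply lt_0_INR; unfold N; lia).
    apply Rmult_le_reg_l with (INR N); [exact HN |].
    eapply Rle_trans; [| eapply Rle_trans; [exact HB |]].
    - apply Rmult_le_compat_l; [lra |].
      eapply Rle_trans; [| apply (rsum_incl _ ((k, n) :: map (fun k => (k, 1%nat)) (seq 0 alpha)))].
      + change (rsum (?p :: ?l) ?x) with (x p + rsum l x). cbv beta.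
        rewrite rsum_map. cbn [fst snd].
        assert (Hpow : forall j, (2 * j <= m)%nat -> r ^ m <= (r ^ j) ^ 2).
        { intros j Hj. rewrite <- pow_mult.
          replace m with (j * 2 + (m - 2 * j))%nat by lia.
          rewrite pow_add. rewrite <- (Rmult_1_r (r ^ (j * 2))) at 2.
          apply Rmult_le_compat_l; [apply pow_le; lra |].
          rewrite <- (pow1 (m - 2 * j)). apply pow_incr; lra. }
        apply Rle_trans with (Cmod (c n k) ^ 2 * r ^ m + rsum (seq 0 alpha) (fun _ => r ^ m)).
        * rewrite rsum_const, length_seq. unfold Q. right; ring.
        * apply Rplus_le_compat.
          -- rewrite Rpow_mult_distr. apply Rmult_le_compat_l; [apply pow2_ge_0 |].
             apply Hpow. unfold m; lia.
          -- apply rsum_le. intros j Hj. apply in_seq in Hj.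
             rewrite (coef_1 _ _ _ _ _ j Hc) by lia. rewrite Cmod_1, Rmult_1_l.
             apply Hpow. unfold m; lia.
      + constructor.
        * rewrite in_map_iff. intros [j [E _]]. injection E; lia.
        * apply (NoDup_map_inv fst). rewrite map_map. simpl. rewrite map_id. apply seq_NoDup.
      + intros [k' n'] [E | Hin].
        * injection E as <- <-. apply in_prod; apply in_seq; unfold K; lia.
        * apply in_map_iff in Hin. destruct Hin as [j [E Hj]]. injection E as <- <-.
          apply in_prod; [exact Hj |]. apply in_seq. unfold K; lia.
      + intros p. apply pow2_ge_0.
    - apply Rle_trans with (rsum (seq 0 N) (fun _ => (M + e) ^ 2)).
      + apply rsum_le. intros j _.
        set (z := (RtoC r * cis _)%C).
        assert (Hz : Cmod z = r) by (unfold z; rewrite Cmod_mult, Cmod_cis, Cmod_R, Rabs_pos_eq; lra).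
        specialize (HK0 z ltac:(lra)).
        specialize (HM z (proj2 (disk_0 1 z) ltac:(lra))).
        apply pow_incr. split; [apply Cmod_ge_0 |].
        rewrite Cmod_sub_sym in HK0.
        pose proof (Cmod_minus_ge (log_trunc alpha K c z) (log_f alpha A z)). lra.
      + rewrite rsum_const, length_seq. lra. }
  assert (H2 : forall r, 0 <= r < 1 -> r ^ m * Q <= M ^ 2).
  { intros r Hr. apply le_epsilon. intros e He.
    set (e' := Rmin 1 (e / (2 * M + 1))).
    assert (He' : 0 < e') by (apply Rmin_pos; [lra | apply Rdiv_lt_0_compat; lra]).
    assert (He1 : e' <= 1) by apply Rmin_l.
    assert (He2 : e' * (2 * M + 1) <= e).
    { replace e with (e / (2 * M + 1) * (2 * M + 1)) by (field; lra).
      apply Rmult_le_compat_r; [lra | apply Rmin_r]. }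
    specialize (H1 r e' Hr He').
    replace ((M + e') ^ 2) with (M ^ 2 + (e' * (2 * M) + e' * e')) in H1 by ring.
    assert (e' * e' <= 1 * e') by (apply Rmult_le_compat_r; lra). lra. }
  apply le_epsilon. intros e He.
  set (d := Rmin 1 (e / (INR m * Q + 1))).
  assert (HmQ : 0 <= INR m * Q) by (apply Rmult_le_pos; [apply pos_INR | exact HQ0]).
  assert (Hd : 0 < d <= 1).
  { split; [apply Rmin_pos; [lra | apply Rdiv_lt_0_compat; lra] | apply Rmin_l]. }
  assert (Hd2 : d * (INR m * Q + 1) <= e).
  { replace e with (e / (INR m * Q + 1) * (INR m * Q + 1)) by (field; lra).
    apply Rmult_le_compat_r; [lra | apply Rmin_r]. }
  specialize (H2 (1 - d) ltac:(lra)).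
  pose proof (one_minus_pow_le d m ltac:(lra)) as Hb.
  assert ((1 - INR m * d) * Q <= (1 - d) ^ m * Q) by (apply Rmult_le_compat_r; assumption).
  lra.
Qed.

(** * The perturbation is contractive *)

Lemma monomial_lipschitz (r : R) (z w : C) (k n : nat) : 0 <= r ->
  Cmod z <= r -> Cmod w <= r ->
  Cmod (Cconj z ^ k * z ^ S n - Cconj w ^ k * w ^ S n)
    <= INR (S n + k) * r ^ (n + k) * Cmod (z - w).
Proof.
  intros Hr Hz Hw.
  assert (step : forall (u v p q : C) (m : nat), Cmod u <= r -> Cmod (u - v) <= Cmod (z - w) ->
    Cmod q <= r ^ S m -> Cmod (p - q) <= INR (S m) * r ^ m * Cmod (z - w) ->
    Cmod (u * p - v * q) <= INR (S (S m)) * r ^ S m * Cmod (z - w)).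
  { intros u v p q m Hu Huv Hq Hpq.
    replace (u * p - v * q)%C with (u * (p - q) + (u - v) * q)%C by ring.
    eapply Rle_trans; [apply Cmod_triangle |]. rewrite !Cmod_mult, (S_INR (S m)).
    pose proof (Rmult_le_compat _ _ _ _ (Cmod_ge_0 u) (Cmod_ge_0 (p - q)) Hu Hpq).
    pose proof (Rmult_le_compat _ _ _ _ (Cmod_ge_0 (u - v)) (Cmod_ge_0 q) Huv Hq).
    simpl pow in *. lra. }
  assert (Hmod : forall k n, Cmod (Cconj w ^ k * w ^ S n) <= r ^ S (n + k)).
  { intros k' n'. rewrite Cmod_mult, !Cmod_pow, Cmod_conj, <- pow_add.
    replace (k' + S n')%nat with (S (n' + k')) by lia.
    apply pow_incr. split; [apply Cmod_ge_0 | exact Hw]. }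
  induction k as [| k IHk].
  - rewrite !Nat.add_0_r. induction n as [| n IHn].
    + simpl. replace (1 * (z * 1) - 1 * (w * 1))%C with (z - w)%C by ring. lra.
    + replace (Cconj z ^ 0 * z ^ S (S n) - Cconj w ^ 0 * w ^ S (S n))%C
        with (z * (Cconj z ^ 0 * z ^ S n) - w * (Cconj w ^ 0 * w ^ S n))%C
        by (rewrite !(Cpow_S _ (S n)); ring).
      apply step; auto; [lra |]. rewrite <- (Nat.add_0_r n) at 2. apply Hmod.
  - rewrite !Nat.add_succ_r.
    replace (Cconj z ^ S k * z ^ S n - Cconj w ^ S k * w ^ S n)%C
      with (Cconj z * (Cconj z ^ k * z ^ S n) - Cconj w * (Cconj w ^ k * w ^ S n))%C
      by (rewrite !(Cpow_S _ k); ring).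
    apply step.
    + now rewrite Cmod_conj.
    + now rewrite <- Cminus_conj, Cmod_conj; apply Rle_refl.
    + apply Hmod.
    + exact IHk.
Qed.

(** The derivative of [r^(m+1) / (1 - r)], the sum of the series of terms
    [(i + 1) * r^i] over [i >= m]. *)
Definition geom_deriv (r : R) (m : nat) : R :=
  r ^ m * (INR (S m) - INR m * r) / (1 - r) ^ 2.

Lemma geom_deriv_nonneg (r : R) (m : nat) : 0 <= r < 1 -> 0 <= geom_deriv r m.
Proof.
  intros Hr. unfold geom_deriv. apply Rdiv_le_0_compat; [| apply pow_lt; lra].
  apply Rmult_le_pos; [apply pow_le; lra |].
  rewrite S_INR. pose proof (pos_INR m). nra.
Qed.

(** [geom_deriv r m - geom_deriv r (S m)] is the term [(m + 1) * r^m], so the sum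
    telescopes. *)
Lemma geom_deriv_tail (r : R) (k p : nat) : 0 <= r < 1 ->
  rsum (seq 2 p) (fun i => INR (i + k) * r ^ (i + k - 1)) <= geom_deriv r (S k).
Proof.
  intros Hr.
  enough (rsum (seq 2 p) (fun i => INR (i + k) * r ^ (i + k - 1))
    = geom_deriv r (S k) - geom_deriv r (S k + p)).
  { rewrite H. pose proof (geom_deriv_nonneg r (S k + p) Hr). lra. }
  induction p as [| p IH].
  - rewrite Nat.add_0_r. simpl. ring.
  - rewrite seq_S, rsum_app, IH. cbn [rsum fold_right].
    replace (2 + p + k - 1)%nat with (S k + p)%nat by lia.
    replace (2 + p + k)%nat with (S (S k + p)) by lia.
    replace (S k + S p)%nat with (S (S k + p)) by lia.
    generalize (S k + p)%nat; intros m. unfold geom_deriv. rewrite !S_INR. simpl.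
    field. lra.
Qed.

(** The Lipschitz constant of [G] on [|z| <= r], with one summand for each power of
    [conj z]: the part of degree one in [z], which for [k = 0] is the identity and has
    been subtracted, and the part of higher degree, of coefficients at most [N]. *)
Definition lip_sum (alpha : nat) (N r : R) : R :=
  rsum (seq 0 alpha) (fun k =>
    (if Nat.eqb k 0 then 0 else INR (S k) * r ^ k) + N * geom_deriv r (S k)).

(** The corresponding bound for [|G|] on [|z| <= r]. *)
Definition dev_sum (alpha : nat) (N r : R) : R :=
  rsum (seq 0 alpha) (fun k =>
    (if Nat.eqb k 0 then 0 else r ^ S k) + N * (r ^ (k + 2) / (1 - r))).

Lemma radius_eq_lip_sum (alpha : nat) (M r : R) : (1 <= alpha)%nat -> r <> 1 ->
  radius_eq alpha M r = 1 - lip_sum alpha (sqrt (M ^ 2 - INR alpha)) r.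
Proof.
  intros Ha Hr. unfold radius_eq. generalize (sqrt (M ^ 2 - INR alpha)). intros N.
  destruct alpha as [| m]; [lia |]. clear Ha.
  enough (lip_sum (S m) N r =
    (1 - (INR (S m) + 1) * r ^ S m + INR (S m) * r ^ (S m + 1)) / (1 - r) ^ 2 - 1
    + r * N / (1 - r) ^ 3 * (2 + r ^ S m * (INR (S m) * r - (INR (S m) + 2)))) by lra.
  induction m as [| m IH].
  - unfold lip_sum, geom_deriv. simpl. field. lra.
  - unfold lip_sum in *. rewrite (seq_S (S m)), rsum_app, IH.
    cbn [rsum fold_right Nat.add Nat.eqb]. unfold geom_deriv. rewrite !S_INR.
    rewrite !Nat.add_1_r. simpl. field. lra.
Qed.

Lemma sigma1_dev_sum (alpha : nat) (M r : R) : (1 <= alpha)%nat -> r <> 1 ->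
  sigma1 alpha M r = r - dev_sum alpha (sqrt (M ^ 2 - INR alpha)) r.
Proof.
  intros Ha Hr. unfold sigma1. generalize (sqrt (M ^ 2 - INR alpha)). intros N.
  destruct alpha as [| m]; [lia |]. clear Ha.
  enough (dev_sum (S m) N r =
    (r ^ 2 - r ^ (S m + 1)) / (1 - r) + N * ((1 - r ^ S m) * r ^ 2 / (1 - r) ^ 2)) by lra.
  induction m as [| m IH].
  - unfold dev_sum. simpl. field. lra.
  - unfold dev_sum in *. rewrite (seq_S (S m)), rsum_app, IH.
    cbn [rsum fold_right Nat.add Nat.eqb]. 
    rewrite !Nat.add_1_r. replace (m + 2)%nat with (S (S m)) by lia. simpl. field. lra.
Qed.

Lemma lip_sum_nonneg (alpha : nat) (N r : R) : 0 <= N -> 0 <= r < 1 -> 0 <= lip_sum alpha N r.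
Proof.
  intros HN Hr. apply rsum_nonneg. intros k _. apply Rplus_le_le_0_compat.
  - destruct (Nat.eqb k 0); [lra |]. apply Rmult_le_pos; [apply pos_INR | apply pow_le; lra].
  - apply Rmult_le_pos; [exact HN | now apply geom_deriv_nonneg].
Qed.

(** A monomial of degree [d] of [G] contributes a multiple of [r^d] to [dev_sum] and [d]
    times as much to [r * lip_sum], and [d >= 2].  At the root of [radius_eq] this yields
    [r1 / 2 <= sigma1]. *)
Lemma dev_sum_le_lip_sum (alpha : nat) (N r : R) : 0 <= N -> 0 <= r < 1 ->
  2 * dev_sum alpha N r <= r * lip_sum alpha N r.
Proof.
  intros HN Hr. unfold dev_sum, lip_sum. rewrite <- !rsum_scal.
  apply rsum_le. intros k _. rewrite !Rmult_plus_distr_l.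
  assert (Hp : 0 <= r ^ k) by (apply pow_le; lra).
  pose proof (pos_INR k) as Hk.
  apply Rplus_le_compat.
  - destruct k as [| k]; simpl Nat.eqb; cbv iota; [lra |].
    replace (r * (INR (S (S k)) * r ^ S k)) with (INR (S (S k)) * r ^ S (S k)) by (simpl pow; ring).
    apply Rmult_le_compat_r; [apply pow_le; lra |].
    rewrite 2!S_INR. pose proof (pos_INR k). lra.
  - replace (r * (N * geom_deriv r (S k))) with (N * (r * geom_deriv r (S k))) by ring.
    replace (2 * (N * (r ^ (k + 2) / (1 - r)))) with (N * (2 * (r ^ (k + 2) / (1 - r)))) by ring.
    apply Rmult_le_compat_l; [exact HN |].
    replace (r * geom_deriv r (S k)) with (2 * (r ^ (k + 2) / (1 - r))
      + r ^ (k + 2) * (INR k * (1 - r) + r) / (1 - r) ^ 2).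
    2:{ unfold geom_deriv. rewrite !S_INR, pow_add. simpl. field. lra. }
    assert (0 <= r ^ (k + 2) * (INR k * (1 - r) + r) / (1 - r) ^ 2); [| lra].
    apply Rdiv_le_0_compat; [| apply pow_lt; lra].
    apply Rmult_le_pos; [apply pow_le; lra | nra].
Qed.

Lemma log_f_minus_id (alpha : nat) (A : nat -> C -> C) (z : C) : (1 <= alpha)%nat ->
  (log_f alpha A z - z)%C = csum (seq 0 alpha) (fun k =>
    (if Nat.eqb k 0 then 0 else Cconj z ^ k * z ^ 1) + Cconj z ^ k * (A k z - z))%C.
Proof.
  intros Ha. rewrite log_f_csum by assumption.
  destruct alpha as [| m]; [lia |]. simpl seq.
  change (csum (0%nat :: ?l) ?u) with (u 0%nat + csum l u)%C. cbn [Nat.eqb].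
  rewrite (csum_ext (seq 1 m) (fun k => _ + _)%C (fun k => Cconj z ^ k * A k z)%C).
  - simpl. ring.
  - intros k Hk. apply in_seq in Hk. destruct k as [| k]; [lia |]. simpl. ring.
Qed.

(** Holds for the partial sums by [monomial_lipschitz] and [geom_deriv_tail], and
    passes to the limit. *)
Lemma pseries_remainder_lipschitz (b : nat -> C) (g : C -> C) (N r : R) (k : nat) (z w : C) :
  0 <= r < 1 -> Cmod z <= r -> Cmod w <= r ->
  b 0%nat = RtoC 0 -> b 1%nat = RtoC 1 -> (forall n, (2 <= n)%nat -> Cmod (b n) <= N) ->
  @is_pseries C_AbsRing C_NormedModule b z (g z) ->
  @is_pseries C_AbsRing C_NormedModule b w (g w) ->
  Cmod (Cconj z ^ k * (g z - z) - Cconj w ^ k * (g w - w))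
    <= N * geom_deriv r (S k) * Cmod (z - w).
Proof.
  intros Hr Hz Hw H0 H1 HN Sz Sw.
  assert (HN0 : 0 <= N) by (eapply Rle_trans; [apply Cmod_ge_0 | apply (HN 2%nat); lia]).
  set (T := fun p x => csum (seq 2 p) (fun i => b i * x ^ i)%C).
  assert (HT : forall p, Cmod (Cconj z ^ k * T p z - Cconj w ^ k * T p w)
     <= N * geom_deriv r (S k) * Cmod (z - w)).
  { intros p. unfold T. rewrite <- !csum_scal, <- csum_minus.
    eapply Rle_trans; [apply Cmod_csum_le |].
    apply Rle_trans with (rsum (seq 2 p)
      (fun i => (N * Cmod (z - w)) * (INR (i + k) * r ^ (i + k - 1)))).
    - apply rsum_le. intros i Hi. apply in_seq in Hi.
      destruct i as [| i]; [lia |].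
      replace (Cconj z ^ k * (b (S i) * z ^ S i) - Cconj w ^ k * (b (S i) * w ^ S i))%C
        with (b (S i) * (Cconj z ^ k * z ^ S i - Cconj w ^ k * w ^ S i))%C by ring.
      rewrite Cmod_mult.
      replace (S i + k - 1)%nat with (i + k)%nat by lia.
      replace (N * Cmod (z - w) * (INR (S i + k) * r ^ (i + k)))
        with (N * (INR (S i + k) * r ^ (i + k) * Cmod (z - w))) by ring.
      apply Rmult_le_compat; try apply Cmod_ge_0.
      + apply HN; lia.
      + apply monomial_lipschitz; lra.
    - rewrite rsum_scal.
      replace (N * geom_deriv r (S k) * Cmod (z - w))
        with (N * Cmod (z - w) * geom_deriv r (S k)) by ring.
      apply Rmult_le_compat_l; [apply Rmult_le_pos; [exact HN0 | apply Cmod_ge_0] |].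
      now apply geom_deriv_tail. }
  assert (HP : forall p x, csum (seq 0 (S (S p))) (fun i => b i * x ^ i)%C = (x + T p x)%C).
  { intros p x. simpl seq.
    change (csum (0%nat :: 1%nat :: ?l) ?u) with (u 0%nat + (u 1%nat + csum l u))%C.
    cbv beta. rewrite H0, H1. fold (T p x). simpl. ring. }
  apply le_epsilon. intros e He.
  destruct (pseries_partial_sums _ _ _ Sz (e / 2) ltac:(lra)) as [N1 HN1].
  destruct (pseries_partial_sums _ _ _ Sw (e / 2) ltac:(lra)) as [N2 HN2].
  set (p := (N1 + N2)%nat).
  specialize (HN1 (S p) ltac:(unfold p; lia)). specialize (HN2 (S p) ltac:(unfold p; lia)).
  rewrite HP in HN1, HN2.
  assert (Hk : forall x d, Cmod x <= r -> Cmod d < e / 2 -> Cmod (Cconj x ^ k * d) <= e / 2).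
  { intros x d Hx Hd. rewrite Cmod_mult, Cmod_pow, Cmod_conj.
    rewrite <- (Rmult_1_l (e / 2)). apply Rmult_le_compat; try apply Cmod_ge_0; try lra.
    - apply pow_le, Cmod_ge_0.
    - rewrite <- (pow1 k). apply pow_incr. split; [apply Cmod_ge_0 | lra]. }
  pose proof (Hk _ _ Hz HN1) as E1. pose proof (Hk _ _ Hw HN2) as E2.
  replace (Cconj z ^ k * (g z - z) - Cconj w ^ k * (g w - w))%C
    with ((Cconj z ^ k * T p z - Cconj w ^ k * T p w)
      + (Cconj w ^ k * (w + T p w - g w) - Cconj z ^ k * (z + T p z - g z)))%C by ring.
  eapply Rle_trans; [apply Cmod_triangle |].
  apply Rplus_le_compat; [apply HT |].
  eapply Rle_trans; [apply Cmod_minus_le |]. lra.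
Qed.

Lemma log_f_remainder_lipschitz (alpha : nat) (f : C -> C) (a A : nat -> C -> C)
    (c : nat -> nat -> C) (N r : R) (z w : C) :
  (1 <= alpha)%nat -> log_analytic_class alpha f a A c ->
  (forall n k, (2 <= n)%nat -> (k < alpha)%nat -> Cmod (c n k) <= N) ->
  0 <= r < 1 -> Cmod z <= r -> Cmod w <= r ->
  Cmod ((log_f alpha A z - z) - (log_f alpha A w - w)) <= lip_sum alpha N r * Cmod (z - w).
Proof.
  intros Ha Hc HN Hr Hz Hw.
  rewrite !log_f_minus_id, <- csum_minus by assumption.
  eapply Rle_trans; [apply Cmod_csum_le |].
  unfold lip_sum. rewrite Rmult_comm, <- rsum_scal.
  apply rsum_le. intros k Hk. apply in_seq in Hk.
  assert (Uz : unit_disk z) by (apply disk_0; lra).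
  assert (Uw : unit_disk w) by (apply disk_0; lra).
  pose proof (pseries_remainder_lipschitz (fun n => c n k) (A k) N r k z w Hr Hz Hw
    (coef_0 _ _ _ _ _ k Hc ltac:(lia)) (coef_1 _ _ _ _ _ k Hc ltac:(lia))
    (fun n Hn => HN n k Hn ltac:(lia))
    (class_series _ _ _ _ _ Hc k z ltac:(lia) Uz)
    (class_series _ _ _ _ _ Hc k w ltac:(lia) Uw)) as H1.
  destruct k as [| k]; cbn [Nat.eqb].
  - match goal with |- Cmod ?x <= _ => replace x with
      (Cconj z ^ 0 * (A 0%nat z - z) - Cconj w ^ 0 * (A 0%nat w - w))%C by ring end.
    lra.
  - pose proof (monomial_lipschitz r z w (S k) 0 ltac:(lra) Hz Hw) as H2.
    replace (1 + S k)%nat with (S (S k)) in H2 by lia. rewrite Nat.add_0_l in H2.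
    match goal with |- Cmod ?x <= _ => replace x with
      ((Cconj z ^ S k * z ^ 1 - Cconj w ^ S k * w ^ 1) +
       (Cconj z ^ S k * (A (S k) z - z) - Cconj w ^ S k * (A (S k) w - w)))%C by ring end.
    eapply Rle_trans; [apply Cmod_triangle |]. lra.
Qed.

Lemma log_f_remainder_bound (alpha : nat) (f : C -> C) (a A : nat -> C -> C)
    (c : nat -> nat -> C) (N r : R) (z : C) :
  (1 <= alpha)%nat -> log_analytic_class alpha f a A c ->
  (forall n k, (2 <= n)%nat -> (k < alpha)%nat -> Cmod (c n k) <= N) ->
  0 <= r < 1 -> Cmod z <= r ->
  Cmod (log_f alpha A z - z) <= dev_sum alpha N r.
Proof.
  intros Ha Hc HN Hr Hz.
  rewrite log_f_minus_id by assumption.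
  eapply Rle_trans; [apply Cmod_csum_le |].
  apply rsum_le. intros k Hk. apply in_seq in Hk.
  assert (Uz : unit_disk z) by (apply disk_0; lra).
  assert (H1 : Cmod (A k z - z) <= N * (r ^ 2 / (1 - r))).
  { pose proof (pseries_tail (fun n => c n k) z (A k z) 1 N r 1 Rlt_0_1 Hr ltac:(lra)) as H.
    simpl csum in H. rewrite (coef_0 _ _ _ _ _ k Hc), (coef_1 _ _ _ _ _ k Hc) in H by lia.
    replace (A k z - (0 * 1 + (1 * (z * 1) + 0)))%C with (A k z - z)%C in H by ring.
    apply H.
    - intros n Hn. rewrite pow1, Rmult_1_r. apply HN; lia.
    - apply (class_series _ _ _ _ _ Hc); [lia | exact Uz]. }
  assert (Hpow : forall j, Cmod (Cconj z ^ j) <= r ^ j).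
  { intros j. rewrite Cmod_pow, Cmod_conj. apply pow_incr. split; [apply Cmod_ge_0 | exact Hz]. }
  assert (H2 : Cmod (Cconj z ^ k * (A k z - z)) <= N * (r ^ (k + 2) / (1 - r))).
  { rewrite Cmod_mult.
    replace (N * (r ^ (k + 2) / (1 - r))) with (r ^ k * (N * (r ^ 2 / (1 - r))))
      by (rewrite pow_add; field; lra).
    apply Rmult_le_compat; try apply Cmod_ge_0; auto. }
  eapply Rle_trans; [apply Cmod_triangle |].
  apply Rplus_le_compat; [| exact H2].
  destruct (Nat.eqb k 0); [rewrite Cmod_0; lra |].
  replace (r ^ S k) with (r ^ k * r) by (simpl; ring).
  rewrite Cmod_mult. simpl (z ^ 1)%C. rewrite Cmult_1_r.
  apply Rmult_le_compat; try apply Cmod_ge_0; auto.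
Qed.

Lemma Cprod_Cexp (u : nat -> C) (n : nat) :
  Cprod (fun k => Cexp (u k)) n = Cexp (csum (seq 0 n) u).
Proof.
  induction n as [| n IH]; [symmetry; apply Cexp_0 |].
  rewrite seq_S, csum_app, Cexp_plus, <- IH. cbn [csum fold_right Cprod Nat.add].
  now rewrite Cplus_0_r.
Qed.

Lemma class_f_exp (alpha : nat) (f : C -> C) (a A : nat -> C -> C)
    (c : nat -> nat -> C) (z : C) :
  (1 <= alpha)%nat -> log_analytic_class alpha f a A c -> Cmod z < 1 ->
  f z = Cexp (z + (log_f alpha A z - z)).
Proof.
  intros Ha Hc Hz. replace (z + (log_f alpha A z - z))%C with (log_f alpha A z) by ring.
  rewrite (class_f _ _ _ _ _ Hc) by now apply disk_0.
  rewrite log_f_csum by assumption.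
  apply (Cprod_Cexp (fun k => Cconj z ^ k * A k z)%C).
Qed.

(** * The least positive root *)

Lemma continuous_spec (g : R -> R) (x e : R) : continuous g x -> 0 < e ->
  exists d, 0 < d /\ forall y, Rabs (y - x) < d -> Rabs (g y - g x) < e.
Proof.
  intros H He. destruct (proj1 (filterlim_locally g (g x)) H (mkposreal e He)) as [d Hd].
  exists d. split; [apply cond_pos |]. intros y Hy. apply (Hd y Hy).
Qed.

Lemma first_zero (g : R -> R) (b : R) : 0 < b ->
  (forall x, 0 <= x <= b -> continuous g x) -> 0 < g 0 -> g b <= 0 ->
  exists r, 0 < r <= b /\ g r = 0 /\ forall s, 0 <= s < r -> 0 < g s.
Proof.
  intros Hb Hg H0 Hgb.
  set (E := fun x => 0 <= x <= b /\ forall t, 0 <= t <= x -> 0 < g t).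
  assert (E0 : E 0).
  { split; [lra |]. intros t Ht. replace t with 0 by lra. exact H0. }
  destruct (completeness E) as [s [Hub Hlub]].
  { exists b. intros x [Hx _]. lra. }
  { now exists 0. }
  assert (Hs0 : 0 <= s) by (now apply Hub).
  assert (Hsb : s <= b) by (apply Hlub; intros x [Hx _]; lra).
  assert (Hlt : forall t, 0 <= t < s -> 0 < g t).
  { intros t Ht. apply Rnot_le_lt. intros Hle.
    assert (s <= t); [| lra]. apply Hlub. intros x [Hx1 Hx2].
    apply Rnot_lt_le. intros Htx. specialize (Hx2 t ltac:(lra)). lra. }
  assert (Hgs : g s = 0).
  { destruct (Rtotal_order (g s) 0) as [Hn | [Hz | Hp]]; [exfalso | exact Hz | exfalso].
    - destruct (continuous_spec g s (- g s) (Hg s ltac:(lra)) ltac:(lra)) as [d [Hd Hc]].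
      destruct Hs0 as [Hs0 | <-]; [| lra].
      set (t := Rmax 0 (s - d / 2)).
      assert (Ht : 0 <= t < s /\ s - d / 2 <= t).
      { split; [split; [apply Rmax_l | apply Rmax_lub_lt; lra] | apply Rmax_r]. }
      specialize (Hc t ltac:(rewrite Rabs_left; lra)).
      specialize (Hlt t (proj1 Ht)). apply Rabs_def2 in Hc. lra.
    - destruct (continuous_spec g s (g s) (Hg s ltac:(lra)) Hp) as [d [Hd Hc]].
      destruct Hsb as [Hsb | ->]; [| lra].
      set (t := Rmin b (s + d / 2)).
      assert (Ht : s < t <= b /\ t <= s + d / 2).
      { split; [split; [apply Rmin_glb_lt; lra | apply Rmin_l] | apply Rmin_r]. }
      assert (t <= s); [| lra]. apply Hub. split; [lra |].
      intros x Hx. destruct (Rlt_dec x s) as [Hxs | Hxs]; [apply Hlt; lra |].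
      specialize (Hc x ltac:(rewrite Rabs_pos_eq; lra)). apply Rabs_def2 in Hc. lra. }
  exists s. repeat split; auto.
  destruct Hs0 as [Hs0 | <-]; [exact Hs0 | lra].
Qed.

Lemma radius_eq_continuous (alpha : nat) (M x : R) : x < 1 -> continuous (radius_eq alpha M) x.
Proof.
  intros Hx. unfold radius_eq. generalize (sqrt (M ^ 2 - INR alpha)); intros N.
  apply (ex_derive_continuous (fun r => 2 - (1 - (INR alpha + 1) * r ^ alpha
    + INR alpha * r ^ (alpha + 1)) / (1 - r) ^ 2
    - r * N / (1 - r) ^ 3 * (2 + r ^ alpha * (INR alpha * r - (INR alpha + 2))))).
  assert (H2 : (1 - x) ^ 2 <> 0) by (apply pow_nonzero; lra).
  assert (H3 : (1 - x) ^ 3 <> 0) by (apply pow_nonzero; lra).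
  auto_derive. simpl in H2, H3. tauto.
Qed.

(** For [alpha >= 2] the sum [1 + 2 r + ...] already reaches [2] at [r = 1/2].  For
    [alpha = 1] the equation is [N * (1 - t^2) = t^2] with [t = 1 - r], and
    [t = N / (1 + N)] makes the left side the larger one. *)
Lemma radius_eq_nonpos (alpha : nat) (M : R) : (1 <= alpha)%nat -> sqrt (INR alpha) <= M ->
  1 < M -> exists b, 0 < b < 1 /\ radius_eq alpha M b <= 0.
Proof.
  intros Ha HM HM1.
  set (N := sqrt (M ^ 2 - INR alpha)).
  assert (HN : 0 <= N) by apply sqrt_pos.
  destruct alpha as [| [| m]]; [lia | |].
  - assert (HN1 : 0 < N) by (apply sqrt_lt_R0; simpl; nra).
    set (t := N / (1 + N)).
    assert (Ht : 0 < t < 1).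
    { unfold t. split; [apply Rdiv_lt_0_compat; lra |].
      apply Rmult_lt_reg_r with (1 + N); [lra |].
      unfold Rdiv. rewrite Rmult_assoc, Rinv_l; lra. }
    assert (Et : t * (1 + N) = N) by (unfold t; field; lra).
    exists (1 - t). split; [lra |].
    rewrite radius_eq_lip_sum by (lia || lra). fold N.
    unfold lip_sum, geom_deriv. simpl.
    replace (1 - (0 + N * ((1 - t) * 1 * (1 + 1 - 1 * (1 - t))
       / ((1 - (1 - t)) * ((1 - (1 - t)) * 1))) + 0))
      with ((t * t - N * (1 - t * t)) / (t * t)) by (field; lra).
    assert (t * t - N * (1 - t * t) <= 0) by nra.
    assert (0 < / (t * t)) by (apply Rinv_0_lt_compat; nra).
    unfold Rdiv. nra.
  - exists (/ 2). split; [lra |].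
    rewrite radius_eq_lip_sum by (lia || lra). fold N.
    unfold lip_sum. simpl seq.
    change (rsum (0%nat :: 1%nat :: ?l) ?x) with (x 0%nat + (x 1%nat + rsum l x)). cbv beta.
    cbn [Nat.eqb].
    match goal with |- context [rsum (seq 2 m) ?x] =>
      assert (0 <= rsum (seq 2 m) x) end.
    { apply rsum_nonneg. intros k _. apply Rplus_le_le_0_compat.
      - destruct (Nat.eqb k 0); [lra |]. apply Rmult_le_pos; [apply pos_INR | apply pow_le; lra].
      - apply Rmult_le_pos; [exact HN | apply geom_deriv_nonneg; lra]. }
    pose proof (Rmult_le_pos _ _ HN (geom_deriv_nonneg (/ 2) 1 ltac:(lra))).
    pose proof (Rmult_le_pos _ _ HN (geom_deriv_nonneg (/ 2) 2 ltac:(lra))).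
    assert (INR 2 * (/ 2) ^ 1 = 1) by (simpl; field). lra.
Qed.

Lemma radius_eq_0 (alpha : nat) (M : R) : (1 <= alpha)%nat -> radius_eq alpha M 0 = 1.
Proof.
  intros Ha. unfold radius_eq. rewrite !pow_i by lia. field.
Qed.

Lemma radius_eq_first_zero (alpha : nat) (M : R) :
  (1 <= alpha)%nat -> sqrt (INR alpha) <= M -> 1 < M ->
  exists r1, 0 < r1 < 1 /\ radius_eq alpha M r1 = 0
    /\ forall s, 0 <= s < r1 -> 0 < radius_eq alpha M s.
Proof.
  intros Ha HM HM1.
  destruct (radius_eq_nonpos alpha M Ha HM HM1) as [b [Hb Hneg]].
  destruct (first_zero (radius_eq alpha M) b) as [r [Hr [E Hpos]]]; try lra.
  - intros x Hx. apply radius_eq_continuous. lra.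
  - rewrite radius_eq_0; lra || lia.
  - exists r. repeat split; auto; lra.
Qed.

Lemma least_positive_root_first_zero (g : R -> R) (r r' : R) :
  least_positive_root g r -> 0 < r' -> g r' = 0 ->
  (forall s, 0 <= s < r' -> 0 < g s) -> r = r'.
Proof.
  intros [H0 [H1 H2]] Hr' E Hpos. apply Rle_antisym; [now apply H2 |].
  apply Rnot_lt_le. intros Hlt. specialize (Hpos r ltac:(lra)). lra.
Qed.

Lemma radius_eq_1_1 (r : R) : radius_eq 1 1 r <> 0.
Proof.
  unfold radius_eq. simpl. replace (1 * (1 * 1) - 1) with 0 by ring. rewrite sqrt_0.
  destruct (Req_dec r 1) as [-> | Hr].
  - replace (1 - (1 + 1) * (1 * 1) + 1 * (1 * (1 * 1))) with 0 by ring. unfold Rdiv. lra.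
  - assert (1 - r <> 0) by lra.
    match goal with |- ?x <> 0 => replace x with 1 by (field; lra) end. lra.
Qed.

(** * The two covering statements *)

Lemma class_schlicht (alpha : nat) (M : R) (f : C -> C) (a A : nat -> C -> C)
    (c : nat -> nat -> C) (r1 : R) :
  (1 <= alpha)%nat -> sqrt (INR alpha) <= M ->
  log_analytic_class alpha f a A c -> log_bounded alpha A M ->
  least_positive_root (radius_eq alpha M) r1 ->
  univalent_on f (disk (RtoC 0) r1) /\
  contains_schlicht_disk f (disk (RtoC 0) r1)
    (RtoC (cosh (sigma1 alpha M r1))) (sinh (sigma1 alpha M r1)).
Proof.
  intros Ha HM Hc Hb Hroot.
  assert (HINR : 1 <= INR alpha) by (apply (le_INR 1); lia).
  assert (HM1 : 1 <= M).
  { eapply Rle_trans; [| exact HM]. rewrite <- sqrt_1. now apply sqrt_le_1_alt. }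
  destruct HM1 as [HM1 | <-].
  2:{ exfalso. assert (E : alpha = 1%nat).
      { apply Nat.le_antisymm; [| exact Ha]. apply INR_le. simpl.
        rewrite <- (sqrt_sqrt (INR alpha)) by lra.
        pose proof (sqrt_pos (INR alpha)). nra. }
      subst alpha. exact (radius_eq_1_1 r1 (proj1 (proj2 Hroot))). }
  destruct (radius_eq_first_zero alpha M Ha HM HM1) as [r' [Hr' [E Hpos]]].
  assert (r1 = r') as -> by (apply (least_positive_root_first_zero _ _ _ Hroot); tauto).
  set (N := sqrt (M ^ 2 - INR alpha)).
  assert (HN0 : 0 <= N) by apply sqrt_pos.
  assert (HN : forall n k, (2 <= n)%nat -> (k < alpha)%nat -> Cmod (c n k) <= N).
  { intros n k Hn Hk. rewrite <- (sqrt_pow2 (Cmod (c n k))) by apply Cmod_ge_0.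
    apply sqrt_le_1_alt.
    pose proof (coef_bound_sqr alpha f a A c M n k Hc Hb Hn Hk). lra. }
  apply (schlicht_of_contraction f (fun z => log_f alpha A z - z)%C).
  - lra.
  - rewrite sigma1_dev_sum by (lia || lra). fold N.
    pose proof (dev_sum_le_lip_sum alpha N r' HN0 ltac:(lra)).
    rewrite radius_eq_lip_sum in E by (lia || lra). fold N in E.
    replace (lip_sum alpha N r') with 1 in H by lra. lra.
  - intros z Hz. apply (class_f_exp alpha f a A c); auto. lra.
  - intros z Hz. rewrite sigma1_dev_sum by (lia || lra). fold N.
    pose proof (log_f_remainder_bound alpha f a A c N r' z Ha Hc HN ltac:(lra) ltac:(lra)). lra.
  - intros r Hr. exists (lip_sum alpha N r). split.
    + split; [apply lip_sum_nonneg; lra |].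
      specialize (Hpos r Hr). rewrite radius_eq_lip_sum in Hpos by (lia || lra).
      fold N in Hpos. lra.
    + intros z w Hz Hw. apply (log_f_remainder_lipschitz alpha f a A c); auto. lra.
Qed.

Lemma class_schlicht_unit_bound (alpha : nat) (f : C -> C) (a A : nat -> C -> C)
    (c : nat -> nat -> C) :
  (1 <= alpha)%nat -> log_analytic_class alpha f a A c -> log_bounded alpha A 1 ->
  univalent_on f unit_disk /\ contains_schlicht_disk f unit_disk (RtoC (cosh 1)) (sinh 1).
Proof.
  intros Ha Hc Hb.
  assert (HINR : 1 <= INR alpha) by (apply (le_INR 1); lia).
  assert (Hcoef : forall n k, (2 <= n)%nat -> (k < alpha)%nat -> INR alpha + Cmod (c n k) ^ 2 <= 1).
  { intros n k Hn Hk. pose proof (coef_bound_sqr alpha f a A c 1 n k Hc Hb Hn Hk). lra. }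
  assert (alpha = 1%nat) as ->.
  { apply Nat.le_antisymm; [| exact Ha]. apply INR_le. simpl.
    specialize (Hcoef 2%nat 0%nat ltac:(lia) ltac:(lia)).
    pose proof (pow2_ge_0 (Cmod (c 2%nat 0%nat))). lra. }
  assert (HN : forall n k, (2 <= n)%nat -> (k < 1)%nat -> Cmod (c n k) <= 0).
  { intros n k Hn Hk. specialize (Hcoef n k Hn Hk). simpl in Hcoef.
    pose proof (Cmod_ge_0 (c n k)). nra. }
  assert (E1 : forall r, lip_sum 1 0 r = 0) by (intros; unfold lip_sum; simpl; ring).
  assert (E2 : forall r, dev_sum 1 0 r = 0) by (intros; unfold dev_sum; simpl; ring).
  apply (schlicht_of_contraction f (fun z => log_f 1 A z - z)%C 1 1).
  - lra.
  - lra.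
  - intros z Hz. apply (class_f_exp 1 f a A c); auto.
  - intros z Hz.
    pose proof (log_f_remainder_bound 1 f a A c 0 (Cmod z) z Ha Hc HN
      (conj (Cmod_ge_0 z) Hz) (Rle_refl _)) as H. rewrite E2 in H. lra.
  - intros r Hr. exists 0. split; [lra |]. intros z w Hz Hw.
    rewrite <- (E1 r). now apply (log_f_remainder_lipschitz 1 f a A c).
Qed.

(** * Sharpness: the exponential function *)

Lemma is_derive_intro (g : C -> C) (z0 l : C) :
  (forall e, 0 < e -> exists d, 0 < d /\ forall z, Cmod (z - z0) < d ->
     Cmod (g z - g z0 - (z - z0) * l) <= e * Cmod (z - z0)) ->
  @is_derive C_AbsRing C_NormedModule g z0 l.
Proof.
  intros H. split.
  - apply (@is_linear_scal_l C_AbsRing C_NormedModule).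
  - intros x Hx e.
    apply (@is_filter_lim_locally_unique C_AbsRing (AbsRing_NormedModule C_AbsRing)) in Hx.
    subst x.
    destruct (H e (cond_pos e)) as [d [Hd Hd']].
    exists (mkposreal d Hd). intros y Hy. apply Hd'. exact Hy.
Qed.

Definition exp_coef (n k : nat) : C := if Nat.eqb n 1 then RtoC 1 else RtoC 0.

Lemma exp_in_class : log_analytic_class 1 Cexp (fun _ => Cexp) (fun _ z => z) exp_coef.
Proof.
  split.
  - apply Cexp_0.
  - intros k _. split; [| split].
    + intros z _. exists (RtoC 1). apply is_derive_intro. intros e He.
      exists 1. split; [lra |]. intros y _.
      replace (y - z - (y - z) * 1)%C with (RtoC 0) by ring. rewrite Cmod_0.
      apply Rmult_le_pos; [lra | apply Cmod_ge_0].
    + reflexivity.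
    + rewrite Cexp_0. symmetry. apply Clog_1.
  - intros k _. apply Cexp_0.
  - intros k _. apply is_derive_intro. intros e He.
    exists (Rmin (/ 2) (e / 4)). split; [apply Rmin_pos; lra |].
    intros z Hz. replace (z - RtoC 0)%C with z in * by ring.
    assert (H1 := Rlt_le_trans _ _ _ Hz (Rmin_l _ _)).
    assert (H2 := Rlt_le_trans _ _ _ Hz (Rmin_r _ _)).
    rewrite Cexp_0. replace (z * 1)%C with z by ring.
    pose proof (Cexp_quadratic z ltac:(lra)). pose proof (Cmod_ge_0 z). nra.
  - intros k z _ _. apply filterlim_locally. intros e.
    exists 1%nat. intros n Hn.
    match goal with |- ball _ _ ?x => assert (E : x = z) end.
    { destruct n as [| n]; [lia |]. clear Hn. induction n as [| n IH].
      - rewrite sum_Sn, sum_O.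
        change (1 * RtoC 0 + (z * 1) * RtoC 1 = z)%C. ring.
      - rewrite sum_Sn, IH.
        change (z + (@pow_n C_Ring z (S (S n))) * RtoC 0 = z)%C. ring. }
    rewrite E. apply ball_center.
  - intros z _. simpl. replace (1 * z)%C with z by ring. ring.
  - intros; lia.
Qed.

Lemma exp_log_bounded : log_bounded 1 (fun _ z => z) 1.
Proof.
  intros z Hz. apply (proj1 (disk_0 1 z)) in Hz. rewrite log_f_csum by lia.
  cbn [csum fold_right seq Cpow]. rewrite Cmult_1_l, Cplus_0_r. lra.
Qed.

Lemma Cmod_Cexp (z : C) : Cmod (Cexp z) = exp (Re z).
Proof.
  replace (Cexp z) with (RtoC (exp (Re z)) * cis (Im z))%C.
  - rewrite Cmod_mult, Cmod_cis, Cmod_R, Rabs_pos_eq; [ring |]. left; apply exp_pos.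
  - unfold Cexp, cis, RtoC, Cmult; simpl. f_equal; ring.
Qed.

(** The disk avoids [0], so [mu <= |w|].  Its points on the line through [0] and [w]
    then have moduli filling the interval from [|w| - mu] to [|w| + mu], which must lie
    between [1/e] and [e]. *)
Lemma exp_schlicht_radius_le (w : C) (mu : R) :
  contains_schlicht_disk Cexp unit_disk w mu -> mu <= sinh 1.
Proof.
  intros [Hmu [X [_ [HXU [_ HX]]]]].
  assert (Him : forall y, disk w mu y -> exp (- (1)) < Cmod y < exp 1).
  { intros y Hy. apply HX in Hy. destruct Hy as [z [Xz <-]].
    apply HXU, (proj1 (disk_0 1 z)) in Xz. rewrite Cmod_Cexp.
    pose proof (re_le_Cmod z) as H. apply Rabs_le_between in H.
    split; apply exp_increasing; lra. }
  assert (Hw : mu <= Cmod w).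
  { apply Rnot_lt_le. intros Hlt. specialize (Him (RtoC 0)).
    rewrite Cmod_0 in Him. pose proof (exp_pos (- (1))).
    assert (disk w mu (RtoC 0)); [| specialize (Him H0); lra].
    unfold disk. rewrite Cmod_sub_sym. now replace (w - RtoC 0)%C with w by ring. }
  assert (Hs : forall t, Rabs t < mu -> exp (- (1)) < Cmod w + t < exp 1).
  { intros t Ht.
    specialize (Him (RtoC (1 + t / Cmod w) * w)%C).
    assert (E : Cmod (RtoC (1 + t / Cmod w) * w) = Cmod w + t).
    { rewrite Cmod_mult, Cmod_R. rewrite Rabs_pos_eq; [field; lra |].
      apply Rmult_le_reg_r with (Cmod w); [lra |].
      replace ((1 + t / Cmod w) * Cmod w) with (Cmod w + t) by (field; lra).
      apply Rabs_def2 in Ht. lra. }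
    rewrite E in Him. apply Him. unfold disk.
    replace (RtoC (1 + t / Cmod w) * w - w)%C with (RtoC (t / Cmod w) * w)%C
      by (rewrite RtoC_plus; ring).
    rewrite Cmod_mult, Cmod_R. unfold Rdiv.
    rewrite Rabs_mult, (Rabs_pos_eq (/ Cmod w)) by (left; apply Rinv_0_lt_compat; lra).
    rewrite Rmult_assoc, Rinv_l; lra. }
  apply Rnot_lt_le. intros Hlt.
  assert (Hsh : 0 < sinh 1) by (rewrite <- sinh_0; apply sinh_lt; lra).
  pose proof (Hs (sinh 1) ltac:(rewrite Rabs_pos_eq; lra)) as H1.
  pose proof (Hs (- sinh 1) ltac:(rewrite Rabs_Ropp, Rabs_pos_eq; lra)) as H2.
  unfold sinh in *. lra.
Qed.

(* For alpha = 1 and M = 1 the function radius_eq alpha M has no positive root;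
   that case is the second clause.  The last two clauses are the sharpness of
   the univalence radius 1 and of the schlicht radius sinh 1. *)
Theorem theorem4p1 :
  (forall (alpha : nat) (M : R), (1 <= alpha)%nat -> sqrt (INR alpha) <= M ->
     (1 < M -> exists r1, least_positive_root (radius_eq alpha M) r1) /\
     forall (f : C -> C) (a A : nat -> C -> C) (c : nat -> nat -> C),
       log_analytic_class alpha f a A c ->
       log_bounded alpha A M ->
       forall r1, least_positive_root (radius_eq alpha M) r1 ->
         univalent_on f (disk (RtoC 0) r1) /\
         contains_schlicht_disk f (disk (RtoC 0) r1)
           (RtoC (cosh (sigma1 alpha M r1))) (sinh (sigma1 alpha M r1)))
  /\
  (forall (alpha : nat) (f : C -> C) (a A : nat -> C -> C) (c : nat -> nat -> C),
     (1 <= alpha)%nat -> log_analytic_class alpha f a A c -> log_bounded alpha A 1 ->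
       univalent_on f unit_disk /\
       contains_schlicht_disk f unit_disk (RtoC (cosh 1)) (sinh 1))
  /\
  (forall R1 : R,
     (forall (alpha : nat) (f : C -> C) (a A : nat -> C -> C) (c : nat -> nat -> C),
        (1 <= alpha)%nat -> log_analytic_class alpha f a A c ->
        log_bounded alpha A 1 -> univalent_on f (disk (RtoC 0) R1)) ->
     R1 <= 1)
  /\
  (forall mu : R,
     (forall (alpha : nat) (f : C -> C) (a A : nat -> C -> C) (c : nat -> nat -> C),
        (1 <= alpha)%nat -> log_analytic_class alpha f a A c ->
        log_bounded alpha A 1 ->
        exists w : C, contains_schlicht_disk f unit_disk w mu) ->
     mu <= sinh 1).
Proof.
  split; [| split; [| split]].
  - intros alpha M Ha HM. split.
    + intros HM1. destruct (radius_eq_first_zero alpha M Ha HM HM1) as [r1 [Hr1 [E Hpos]]].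
      exists r1. repeat split; [lra | exact E |].
      intros s Hs Es. apply Rnot_lt_le. intros Hlt. specialize (Hpos s ltac:(lra)). lra.
    + intros f a A c Hc Hb r1 Hr1. now apply (class_schlicht alpha M f a A c).
  - intros alpha f a A c. apply class_schlicht_unit_bound.
  - intros R1 H.
    destruct (H 1%nat _ _ _ _ (Nat.le_refl _) exp_in_class exp_log_bounded) as [Hsub _].
    apply Rnot_lt_le. intros HR.
    assert (H1 : disk (RtoC 0) R1 (RtoC 1)) by (apply disk_0; now rewrite Cmod_1).
    apply Hsub, (proj1 (disk_0 1 1)) in H1. rewrite Cmod_1 in H1. lra.
  - intros mu H.
    destruct (H 1%nat _ _ _ _ (Nat.le_refl _) exp_in_class exp_log_bounded) as [w Hw].
    now apply (exp_schlicht_radius_le w).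
Qed.
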